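(* Let $(X_1,Y_1),\ldots,(X_{m+1},Y_{m+1})$ be data points, $R(\cdot,\cdot)$ a fixed (pre-trained) non-negative real-valued score function, and $R_i=R(X_i,Y_i)$ for $1\le i\le m+1$. Suppose $R_1,\ldots,R_{m+1}$ are independent continuous random variables, and let $F_i(z)=\mathbb P(R_i<z)$ for $1\le i\le m+1$, $z\in\mathbb R$. Let $\kappa_i=d_{\mathrm{KS}}(F_i,F_{m+1})$ for $1\le i\le m$ and $\overline F(z)=\frac1m\sum_{i=1}^mF_i(z)$. Let $R_{(1)}\le\cdots\le R_{(m)}$ be the order statistics of $R_1,\ldots,R_m$, let $\alpha\in(0,1)$, and let $\widehat C_{m,\alpha}(X_{m+1})=\{y:R(X_{m+1},y)\le R_{(\lceil(m+1)(1-\alpha)\rceil)}\}$. Then $$-\delta\le\mathbb P\big(Y_{m+1}\in\widehat C_{m,\alpha}(X_{m+1})\big)-(1-\alpha)\le\frac1{m+1}+\delta,$$ where $$\delta=d_{\mathrm{KS}}(\overline F(R_{m+1}),U(0,1))+\Big(\sum_{i=1}^m\kappa_i^2\Big)\Big[I_m+d_{\mathrm{KS}}(\overline F(R_{m+1}),U(0,1))\Big].$$ Moreover, for the modified prediction set $\widehat C^{\mathrm{mod}}_{m,\alpha}(X_{m+1})=\{y:R(X_{m+1},y)\le R_{(m+1-\lfloor2m\alpha/3\rfloor)}\}$, $$\mathbb P\big(Y_{m+1}\in\widehat C^{\mathrm{mod}}_{m,\alpha}(X_{m+1})\big)-(1-\alpha)\ge-3\,d_{\mathrm{KS}}(\overline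 F(R_{m+1}),U(0,1)).$$
   Context: $d_{\mathrm{KS}}$ is the Kolmogorov–Smirnov distance: $d_{\mathrm{KS}}(Y_1,Y_2)=\sup_{t\in\mathbb R}|\mathbb P(Y_1\le t)-\mathbb P(Y_2\le t)|$, applied to random variables or to their laws (so $\kappa_i=\sup_z|F_i(z)-F_{m+1}(z)|$). $U(0,1)$ is a standard uniform random variable. A continuous random variable is one with a continuous distribution function. The constant $I_m$ is $$I_m=\begin{cases}1&\text{if }m\le4,\\1-\sqrt{1-\frac4m}+\frac2m\log\left(\frac{1+\sqrt{1-(4/m)}}{1-\sqrt{1-(4/m)}}\right)&\text{if }m>4.\end{cases}$$ Convention: $R_{(m+1)}=+\infty$. *)

(* Defs.v *)
From HB Require Import structures.
From mathcomp Require Import all_boot all_order all_algebra.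
From mathcomp Require Import all_classical all_reals all_analysis.

Set Implicit Arguments.
Unset Strict Implicit.
Unset Printing Implicit Defensive.

Import Order.TTheory GRing.Theory Num.Theory.
Import numFieldNormedType.Exports.

Local Open Scope classical_set_scope.
Local Open Scope ring_scope.

(* The product rule is required for every subfamily J, and B ranges over all
   families of Borel sets. *)
Definition mutually_independent d (T : measurableType d) (R : realType)
    (P : probability T R) (I : finType) (Z : I -> {RV P >-> R}) : Prop :=
  forall (J : {set I}) (B : I -> set R),
    (forall i, i \in J -> measurable (B i)) ->
    P (\bigcap_(i in [set` J]) (Z i @^-1` B i)) =
    (\prod_(i in J) P (Z i @^-1` B i))%E.

Definition continuous_rv d (T : measurableType d) (R : realType)
    (P : probability T R) (Z : {RV P >-> R}) : Prop :=
  continuous (fun t : R => fine (cdf Z t)).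

(* For functions with values in [0, 1] the supremum is over a nonempty bounded
   set, so the real-valued [sup] is the genuine one. *)
Definition ks_dist (R : realType) (F G : R -> R) : R :=
  sup (range (fun t => `|F t - G t|)).

Definition ks_dist_law (R : realType)
    (mu nu : set (measurableTypeR R) -> \bar R) : R :=
  ks_dist (fun t => fine (mu `]-oo, t]%classic))
          (fun t => fine (nu `]-oo, t]%classic)).

Definition I_const (R : realType) (m : nat) : R :=
  if (m <= 4)%N then 1 else
  let s : R := Num.sqrt (1 - 4 / m%:R) in
  1 - s + 2 / m%:R * ln ((1 + s) / (1 - s)).

(* The k-th smallest value (k counted from 1) of a real family of size m;
   it is +oo for k = m + 1. The value at k = 0 is never used. *)
Definition order_stat (R : realType) (m : nat) (x : 'I_m -> R) (k : nat) :
    \bar R :=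
  nth +oo%E [seq r%:E | r <- sort <=%R [seq x i | i <- enum 'I_m]] k.-1.

Definition prediction_set (R : realType) (XT YT : Type) (score : XT -> YT -> R)
    (q : \bar R) (x : XT) : set YT :=
  [set y | ((score x y)%:E <= q)%E].

Section conformal.
Context d (T : measurableType d) (R : realType) (P : probability T R) (m : nat).
Variable Z : 'I_m.+1 -> {RV P >-> R}.

(* The scores R_1, ..., R_(m+1) are Z 0, ..., Z m: the first m of them are the
   calibration scores, and the last one is Z ord_max. *)
Definition calib (i : 'I_m) : 'I_m.+1 := widen_ord (leqnSn m) i.

Definition score_df (i : 'I_m.+1) (z : R) : R :=
  fine (P [set w | Z i w < z]).

Definition kappa (i : 'I_m) : R :=
  ks_dist (score_df (calib i)) (score_df ord_max).

Definition avg_df (z : R) : R :=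
  m%:R^-1 * \sum_(i < m) score_df (calib i) z.

Definition ks_unif : R :=
  ks_dist_law (pushforward P (fun w => avg_df (Z ord_max w)))
              (uniform_prob (@ltr01 R)).

Definition conformal_delta : R :=
  ks_unif + (\sum_(i < m) kappa i ^+ 2) * (I_const R m + ks_unif).

Definition calib_quantile (k : nat) (w : T) : \bar R :=
  order_stat (fun i : 'I_m => Z (calib i) w) k.

(* The argument of [Num.ceil] (resp. [Num.floor]) below is nonnegative for
   0 < alpha < 1, hence `|_|%N is just the conversion from int to nat. *)
Definition conformal_rank (alpha : R) : nat :=
  `|Num.ceil (m.+1%:R * (1 - alpha))|%N.

Definition conformal_rank_mod (alpha : R) : nat :=
  (m.+1 - `|Num.floor (2 * m%:R * alpha / 3)|)%N.

End conformal.

(* Main.v *)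
Require Import Defs.
From HB Require Import structures.
From mathcomp Require Import all_boot all_order all_algebra.
From mathcomp Require Import all_classical all_reals all_analysis.
From mathcomp Require Import measurable_realfun ring lra zify.

(* Let [W = Fbar (R_(m+1))] and, given [R_(m+1) = z], let [N] be the number of calibration
   scores below [z]: a sum of independent Bernoulli variables with parameters [F_i z],
   of mean [m p] with [p = Fbar z]. A miss is the event [k <= N].

   Two-sided bound. The distribution function of [N] is compared with the one of the
   binomial law of parameters [m, p]. The error is at most half the sum of the
   [(F_i z - p)^2], by moving pairs of parameters towards their mean, and at most
   [1 / (m p (1 - p))] times this sum, by Stein's method. Since
   [1 / (p (1 - p)) = 1 / p + 1 / (1 - p)], the minimum of the two factors is at most
   [t p + t (1 - p)] where [t x = min (1/2) (1 / (m x))]. Both [t] and the binomial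
   distribution function, as a function of [p], are monotone, so their expectations at
   [W] and at a uniform variable differ by at most their range times the
   Kolmogorov-Smirnov distance; for the uniform variable the expectations are explicit.

   One-sided bound. If [q] is the [j]-th largest calibration score, then the sum of the
   [1 - F_i q] has expectation at most [j]: removing [R_i] can only lower the threshold,
   and [R_i] is then independent of it, so the sum is dominated by the expected number of
   calibration scores among the [j] largest ones. *)

Set Implicit Arguments.
Unset Strict Implicit.
Unset Printing Implicit Defensive.

Import Order.TTheory GRing.Theory Num.Theory.
Import numFieldNormedType.Exports.

(** * Generating functions of sums of independent Bernoulli variables *)

Local Open Scope ring_scope.

(** The expectation of [h N] when [Q] is the probability generating function of [N]. It is linear in
    [Q] and makes sense for every polynomial, so derivatives of generating functions are allowed. *)
Definition pgf_expect (R : nzRingType) (h : nat -> R) (Q : {poly R}) : R :=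
  \sum_(j < size Q) Q`_j * h j.

Definition pgf_bern (R : nzRingType) (p : R) : {poly R} := (1 - p)%:P + p *: 'X.

Section PgfExpect.
Variable R : realFieldType.
Implicit Types (h : nat -> R) (p q : R) (Q : {poly R}) (n : nat).

Lemma pgf_expect_widen h Q n : (size Q <= n)%N ->
  pgf_expect h Q = \sum_(j < n) Q`_j * h j.
Proof.
move=> sQn; rewrite /pgf_expect (big_ord_widen_cond n xpredT (fun j => Q`_j * h j) sQn).
rewrite big_mkcond /=; apply: eq_bigr => j _.
by case: ltnP => // /(nth_default 0) ->; rewrite mul0r.
Qed.

Lemma pgf_expectD h Q1 Q2 : pgf_expect h (Q1 + Q2) = pgf_expect h Q1 + pgf_expect h Q2.
Proof.
set n := maxn (size Q1) (size Q2).
rewrite !(@pgf_expect_widen h _ n) ?leq_maxl ?leq_maxr ?size_polyD // -big_split /=.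
by apply: eq_bigr => j _; rewrite coefD mulrDl.
Qed.

Lemma pgf_expectZ h c Q : pgf_expect h (c *: Q) = c * pgf_expect h Q.
Proof.
rewrite (@pgf_expect_widen h (c *: Q) (size Q)) ?size_scale_leq // mulr_sumr.
by apply: eq_bigr => j _; rewrite coefZ mulrA.
Qed.

Lemma pgf_expect_sum h (I : Type) (r : seq I) (P : pred I) (F : I -> {poly R}) :
  pgf_expect h (\sum_(i <- r | P i) F i) = \sum_(i <- r | P i) pgf_expect h (F i).
Proof.
apply: (big_morph (pgf_expect h) (@pgf_expectD h)).
by rewrite /pgf_expect size_poly0 big_ord0.
Qed.

Lemma pgf_expectMX h Q : pgf_expect h (Q * 'X) = pgf_expect (fun j => h j.+1) Q.
Proof.
rewrite (@pgf_expect_widen h _ (size Q).+1); last first.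
  by apply: leq_trans (size_polyMleq _ _) _; rewrite size_polyX addn2.
rewrite big_ord_recl coefMX mul0r add0r.
by apply: eq_bigr => j _; rewrite coefMX.
Qed.

Lemma pgf_expect_Xn h n : pgf_expect h 'X^n = h n.
Proof.
rewrite /pgf_expect size_polyXn big_ord_recr /= coefXn eqxx mul1r big1 ?add0r //.
by move=> j _; rewrite coefXn ltn_eqF ?mul0r.
Qed.

Lemma pgf_expect_bern h p Q :
  pgf_expect h (pgf_bern p * Q) =
  (1 - p) * pgf_expect h Q + p * pgf_expect (fun j => h j.+1) Q.
Proof.
by rewrite mulrDl mul_polyC -scalerAl ['X * Q]mulrC pgf_expectD !pgf_expectZ pgf_expectMX.
Qed.

Lemma pgf_expectDl h1 h2 Q :
  pgf_expect (fun j => h1 j + h2 j) Q = pgf_expect h1 Q + pgf_expect h2 Q.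
Proof. by rewrite -big_split; apply: eq_bigr => j _; rewrite mulrDr. Qed.

Lemma pgf_expectZl c h Q : pgf_expect (fun j => c * h j) Q = c * pgf_expect h Q.
Proof. by rewrite mulr_sumr; apply: eq_bigr => j _; rewrite mulrCA. Qed.

Lemma pgf_expectBl h1 h2 Q :
  pgf_expect (fun j => h1 j - h2 j) Q = pgf_expect h1 Q - pgf_expect h2 Q.
Proof. by rewrite -sumrB; apply: eq_bigr => j _; rewrite mulrBr. Qed.

Lemma pgf_expect_cst c Q : pgf_expect (fun=> c) Q = c * Q.[1].
Proof.
rewrite horner_coef mulr_sumr; apply: eq_bigr => j _.
by rewrite expr1n mulr1 mulrC.
Qed.

(** Derivation puts the factor [j] on the coefficient of ['X^j] and lowers the degree by one; this
    is what later expands [E[N h(N)]] over the individual Bernoulli variables. *)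
Lemma pgf_expect_deriv h Q :
  pgf_expect (fun j => j%:R * h j) Q = pgf_expect (fun j => h j.+1) Q^`().
Proof.
rewrite (@pgf_expect_widen _ Q (size Q).+1) // (@pgf_expect_widen _ Q^`() (size Q)); last first.
  exact: leq_trans (size_poly _ _) (leq_pred _).
rewrite big_ord_recl mul0r mulr0 add0r; apply: eq_bigr => j _.
by rewrite coef_deriv mulrA mulr_natr.
Qed.

Lemma pgf_expect_le n h1 h2 Q : (size Q <= n)%N -> (forall j, 0 <= Q`_j) ->
  (forall j, (j < n)%N -> h1 j <= h2 j) -> pgf_expect h1 Q <= pgf_expect h2 Q.
Proof.
move=> sQ Q0 hh; apply: ler_sum => j _; apply: ler_wpM2l => //.
by apply: hh; apply: leq_trans sQ.
Qed.

Lemma pgf_expect_norm_le n h c Q : (size Q <= n)%N -> (forall j, 0 <= Q`_j) -> Q.[1] = 1 ->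
  (forall j, (j < n)%N -> `|h j| <= c) -> `|pgf_expect h Q| <= c.
Proof.
move=> sQ Q0 Q1 hc; rewrite ler_norml -[leLHS]mulr1 -[X in _ && (_ <= X)]mulr1 -Q1.
rewrite -!pgf_expect_cst; apply/andP; split; apply: (pgf_expect_le sQ) => // j /hc.
  by rewrite ler_norml => /andP[].
by rewrite ler_norml => /andP[].
Qed.

Lemma pgf_bern1 p : (pgf_bern p).[1] = 1.
Proof. by rewrite /pgf_bern !hornerE subrK. Qed.

Lemma size_pgf_bern p : (size (pgf_bern p) <= 2)%N.
Proof.
rewrite /pgf_bern (leq_trans (size_polyD _ _)) // geq_max (leq_trans (size_polyC_leq1 _)) //=.
by rewrite (leq_trans (size_scale_leq _ _)) // size_polyX.
Qed.

Lemma coef_pgf_bern_ge0 p j : 0 <= p <= 1 -> 0 <= (pgf_bern p)`_j.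
Proof.
move=> /andP[p0 p1]; rewrite /pgf_bern coefD coefC coefZ coefX.
by case: j => [|[|j]] /=; rewrite ?mulr0 ?addr0 ?mulr1 ?add0r ?subr_ge0.
Qed.

Section Product.
Variables (I : finType).
Implicit Types (P : pred I) (f : I -> R).

Definition pgf_indep P f : {poly R} := \prod_(i | P i) pgf_bern (f i).

Lemma pgf_indep1 P f : (pgf_indep P f).[1] = 1.
Proof. by rewrite /pgf_indep horner_prod big1 // => i _; rewrite pgf_bern1. Qed.

Lemma coef_pgf_indep_ge0 P f : (forall i, P i -> 0 <= f i <= 1) ->
  forall j, 0 <= (pgf_indep P f)`_j.
Proof.
move=> f01; rewrite /pgf_indep; apply: (big_ind (fun Q : {poly R} => forall j, 0 <= Q`_j)).
- by move=> j; rewrite coef1; case: eqP.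
- by move=> Q1 Q2 h1 h2 j; rewrite coefM sumr_ge0 // => k _; rewrite mulr_ge0.
- by move=> i Pi j; rewrite coef_pgf_bern_ge0 // f01.
Qed.

Lemma size_pgf_indep P f : (size (pgf_indep P f) <= #|P|.+1)%N.
Proof.
rewrite /pgf_indep -sum1_card.
elim/big_rec2: _ => [|i n Q _ sQ]; first by rewrite size_poly1.
apply: leq_trans (size_polyMleq _ _) _.
by move: (size_pgf_bern (f i)) sQ; move: (size _) (size _) => a b; lia.
Qed.

Lemma pgf_indepD1 P f i : P i ->
  pgf_indep P f = pgf_bern (f i) * pgf_indep (fun j => P j && (j != i)) f.
Proof. by move=> Pi; rewrite /pgf_indep (bigD1 i). Qed.

Lemma eq_pgf_indep P f g : (forall i, P i -> f i = g i) -> pgf_indep P f = pgf_indep P g.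
Proof. by move=> fg; apply: eq_bigr => i /fg ->. Qed.

End Product.
End PgfExpect.

(** * Comparison with the binomial law by averaging pairs of parameters *)

Section RobinHood.
Variables (R : realFieldType) (I : finType).
Implicit Types (h : nat -> R) (p q : R) (Q : {poly R}) (n : nat) (f : I -> R).

(** Once the sum [a + b] is fixed, the two parameters matter only through their product, which
    multiplies an expected second difference of [h]. *)
Lemma pgf_expect_bern2 h a b Q :
  pgf_expect h (pgf_bern a * (pgf_bern b * Q)) =
  pgf_expect h Q + (a + b) * (pgf_expect (fun j => h j.+1) Q - pgf_expect h Q) +
  a * b * pgf_expect (fun j => h j.+2 - 2 * h j.+1 + h j) Q.
Proof.
rewrite !pgf_expect_bern pgf_expectDl pgf_expectBl pgf_expectZl; ring.
Qed.

Lemma pgf_indepD2 f i j : i != j ->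
  pgf_indep xpredT f = pgf_bern (f i) * (pgf_bern (f j) *
    pgf_indep (fun k => (k != i) && (k != j)) f).
Proof.
by move=> ij; rewrite (pgf_indepD1 f (isT : xpredT i)) (@pgf_indepD1 _ _ _ f j) 1?eq_sym.
Qed.

Lemma mean_straddle f p i0 : \sum_i f i = #|I|%:R * p -> f i0 != p ->
  exists i j, f i < p < f j.
Proof.
move=> sf fi0.
have s0 : \sum_i (f i - p) = 0.
  by rewrite sumrB sf sumr_const mulr_natl subrr.
have [i fi] : exists i, f i < p.
  apply/existsP; apply: contraT; rewrite negb_exists => /forallP h.
  have /eqP := s0; rewrite psumr_eq0 => [/allP/(_ i0)|i _]; last by rewrite subr_ge0 leNgt.
  by rewrite mem_index_enum subr_eq0 (negPf fi0) => /(_ isT).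
have [j fj] : exists j, p < f j.
  apply/existsP; apply: contraT; rewrite negb_exists => /forallP h.
  have /eqP := s0; rewrite -oppr_eq0 -sumrN psumr_eq0 => [/allP/(_ i0)|k _]; last first.
    by rewrite opprB subr_ge0 leNgt.
  by rewrite mem_index_enum opprB subr_eq0 eq_sym (negPf fi0) => /(_ isT).
by exists i, j; rewrite fi fj.
Qed.

(* Moving two parameters on opposite sides of [p] towards each other until one of
   them equals [p] changes the expectation by at most half the decrease of the sum of
   squares. *)
Lemma pgf_indep_binomial_half h f p :
  (forall j, `|h j.+2 - 2 * h j.+1 + h j| <= 1) ->
  (forall i, 0 <= f i <= 1) -> \sum_i f i = #|I|%:R * p ->
  `|pgf_expect h (pgf_indep xpredT f) - pgf_expect h (pgf_indep xpredT (fun _ : I => p))| <=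
  2^-1 * \sum_i (f i - p) ^+ 2.
Proof.
move=> h2; have [n] := ubnP #|[pred i | f i != p]|.
elim: n f => // n IH f; rewrite ltnS => cf f01 sf.
have [/existsP[i0 fi0]|] := boolP [exists i, f i != p]; last first.
  rewrite negb_exists => /forallP fp.
  rewrite (@eq_pgf_indep _ _ _ f (fun=> p)); last first.
    by move=> i _; apply/eqP/negPn/fp.
  by rewrite subrr normr0 mulr_ge0 ?invr_ge0 ?ler0n ?sumr_ge0 // => i _; rewrite sqr_ge0.
have [i [j /andP[fi fj]]] := mean_straddle sf fi0.
have ij : i != j by apply: contraTneq fi => ->; rewrite -leNgt ltW.
(* The parameter [f i] is moved to [p] and [f j] takes up the difference, so that the sum is
   preserved; the new value stays between [f i] and [f j]. *)
pose g k := if k == i then p else if k == j then f i + f j - p else f k.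
have gi : g i = p by rewrite /g eqxx.
have gj : g j = f i + f j - p by rewrite /g eq_sym (negPf ij) eqxx.
have gk k : k != i -> k != j -> g k = f k by rewrite /g => /negPf -> /negPf ->.
have sumD (F : I -> R) : \sum_k F k = F i + (F j + \sum_(k | (k != i) && (k != j)) F k).
  by rewrite (bigD1 i) // (bigD1 j) 1?eq_sym.
have sg : \sum_k g k = #|I|%:R * p.
  rewrite -sf !sumD gi gj.
  by rewrite (eq_bigr f) => [|k /andP[ki kj]]; [ring | rewrite gk].
have g01 k : 0 <= g k <= 1.
  rewrite /g; case: ifP => _; last case: ifP => _ //; have := f01 i; have := f01 j; lra.
have cg : (#|[pred k | g k != p]| < n)%N.
  apply: leq_trans cf; apply: proper_card; apply/properP; split.
    apply/fintype.subsetP => k; rewrite !inE /g; case: ifP => [_|_]; first by rewrite eqxx.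
    by case: ifP => // /eqP -> _; rewrite gt_eqF.
  by exists i; rewrite !inE ?gi ?eqxx // lt_eqF.
have {IH} IHg := IH g cg g01 sg.
set Q := pgf_indep (fun k => (k != i) && (k != j)) f.
have Q0 k : 0 <= Q`_k by apply: coef_pgf_indep_ge0.
have dQ : `|pgf_expect (fun j => h j.+2 - 2 * h j.+1 + h j) Q| <= 1.
  by apply: (pgf_expect_norm_le (leqnn _)) => //; apply: pgf_indep1.
(* The product of the two parameters grows by [(p - f i) (f j - p)], while the sum of squares drops
   by twice that amount. *)
have EQ : pgf_expect h (pgf_indep xpredT f) - pgf_expect h (pgf_indep xpredT g) =
    (p - f i) * (f j - p) * - pgf_expect (fun j => h j.+2 - 2 * h j.+1 + h j) Q.
  rewrite !(pgf_indepD2 _ ij) (_ : pgf_indep _ g = Q); last first.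
    by apply: eq_pgf_indep => k /andP[ki kj]; rewrite gk.
  rewrite !pgf_expect_bern2 gi gj; ring.
have dE : `|pgf_expect h (pgf_indep xpredT f) - pgf_expect h (pgf_indep xpredT g)| <=
    (p - f i) * (f j - p).
  have c0 : 0 <= (p - f i) * (f j - p) by rewrite mulr_ge0 ?subr_ge0 ?ltW.
  by rewrite EQ normrM normrN (ger0_norm c0) ler_piMr.
have sq : \sum_k (f k - p) ^+ 2 = \sum_k (g k - p) ^+ 2 + 2 * ((p - f i) * (f j - p)).
  rewrite !sumD gi gj [in RHS](eq_bigr (fun k => (f k - p) ^+ 2)); first by ring.
  by move=> k /andP[ki kj]; rewrite gk.
rewrite sq; apply: le_trans (ler_distD (pgf_expect h (pgf_indep xpredT g)) _ _) _.
lra.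
Qed.
End RobinHood.

(** * Stein's method for the binomial law *)

Section Binomial.
Variables (R : realFieldType) (m : nat) (p : R).
Hypothesis p01 : 0 < p < 1.
Implicit Types (h : nat -> R).

Definition binom_mass (l : nat) : R := (pgf_bern p ^+ m)`_l.
Local Notation b := binom_mass.

Lemma binom_massE l : b l = ((1 - p) ^+ (m - l) * p ^+ l) *+ 'C(m, l).
Proof.
have [lm|ml] := leqP l m; last first.
  rewrite bin_small // mulr0n /b nth_default //.
  apply: leq_trans (size_poly_exp_leq _ _) _.
  have : ((size (pgf_bern p)).-1 <= 1)%N by have := size_pgf_bern p; case: (size _) => [|[|[]]].
  by move=> s1; apply: leq_ltn_trans ml; rewrite -[leqRHS]mul1n leq_mul2r s1 orbT.
rewrite /b exprDn coef_sum (bigD1 (inord l)) //= big1 => [|i /eqP il].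
  rewrite addr0 inordK // coefMn exprZn -polyC_exp -scalerAr coefZ coefCM coefXn eqxx.
  by rewrite mulr1 mulrC.
rewrite coefMn exprZn -polyC_exp -scalerAr coefZ coefCM coefXn.
case: eqP => [li|_]; last by rewrite !mulr0 mul0rn.
by case: il; apply/val_inj; rewrite /= inordK ?ltnS // li.
Qed.

Lemma binom_mass_gt0 l : (l <= m)%N -> 0 < b l.
Proof.
move=> lm; have [p0 p1] := andP p01.
by rewrite binom_massE pmulrn_lgt0 ?bin_gt0 // mulr_gt0 ?exprn_gt0 ?subr_gt0.
Qed.

(** Detailed balance for the birth-death chain with up rate [(m - l) p] and down rate [l (1 - p)].
    At [l = m] both sides vanish. *)
Lemma binom_mass_rec l : (l <= m)%N ->
  (m%:R - l%:R) * p * b l = l.+1%:R * (1 - p) * b l.+1.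
Proof.
move=> lm; rewrite !binom_massE.
have [->|ml] := eqVneq l m; first by rewrite subrr !mul0r [in RHS]bin_small // mulr0n mulr0.
have {ml} lm' : (l < m)%N by rewrite ltn_neqAle ml.
rewrite -natrB // -[_ *+ 'C(m, l)]mulr_natr -[_ *+ 'C(m, l.+1)]mulr_natr -(subnSK lm') !exprS.
have e : (m - l)%:R * 'C(m, l)%:R = l.+1%:R * 'C(m, l.+1)%:R :> R.
  by rewrite -!natrM mul_bin_left.
rewrite subnSK //.
transitivity (((m - l)%:R * 'C(m, l)%:R) * (p * (1 - p) * (1 - p) ^+ (m - l.+1) * p ^+ l)); first by ring.
rewrite e; ring.
Qed.

Lemma sum_binom_mass : \sum_(0 <= l < m.+1) b l = 1.
Proof.
rewrite big_mkord -[RHS](expr1n _ m) -(pgf_bern1 p) -horner_exp.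
rewrite (@horner_coef_wide _ m.+1).
  by apply: eq_bigr => l _; rewrite expr1n mulr1.
apply/leq_sizeP => l ml; rewrite -/(b l) binom_massE bin_small //.
Qed.

(* Both truncated means below telescope, because
   [(l - m p) b l = l q b l - (l + 1) q b (l + 1)] with [q = 1 - p]. *)
Lemma binom_centered l : (l <= m)%N ->
  (l%:R - m%:R * p) * b l = l%:R * (1 - p) * b l - l.+1%:R * (1 - p) * b l.+1.
Proof. by move=> lm; rewrite -binom_mass_rec //; ring. Qed.

(** By balance the right side is the telescoping sum of [(l - m p) b l] over [l > i]; replacing [l]
    by [i] in the first factor can only decrease it. *)
Lemma binom_upper_mean i : (i <= m)%N ->
  (\sum_(i.+1 <= l < m.+1) b l) * (i%:R - m%:R * p) <= (m%:R - i%:R) * p * b i.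
Proof.
move=> im; rewrite binom_mass_rec // mulr_suml.
have -> : i.+1%:R * (1 - p) * b i.+1 = \sum_(i.+1 <= l < m.+1) (l%:R - m%:R * p) * b l.
  rewrite (eq_big_nat _ _ (F2 := fun l => - ((l.+1%:R * (1 - p) * b l.+1) - l%:R * (1 - p) * b l))).
    rewrite sumrN telescope_sumr // [in m.+1%:R * _ * _]binom_massE bin_small //.
    by rewrite mulr0n mulr0 sub0r opprK.
  by move=> l /andP[_ lm]; rewrite binom_centered // opprB.
rewrite big_nat_cond [leRHS]big_nat_cond; apply: ler_sum => l /andP[/andP[il lm] _].
rewrite mulrC; apply: ler_wpM2r; first by rewrite ltW ?binom_mass_gt0.
by rewrite lerD2r ler_nat ltnW.
Qed.

Lemma binom_lower_mean i : (i <= m)%N ->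
  (\sum_(0 <= l < i) b l) * (m%:R * p - i%:R) <= i%:R * (1 - p) * b i.
Proof.
move=> im; rewrite mulr_suml.
have -> : i%:R * (1 - p) * b i = \sum_(0 <= l < i) (m%:R * p - l%:R) * b l.
  rewrite (eq_big_nat _ _ (F2 := fun l => (l.+1%:R * (1 - p) * b l.+1) - l%:R * (1 - p) * b l)).
    by rewrite telescope_sumr // mul0r mul0r subr0.
  move=> l /andP[_ li]; have lm : (l <= m)%N by apply: leq_trans im; apply: ltnW.
  by rewrite -[LHS]opprK -mulNr opprB binom_centered // opprB.
rewrite big_nat_cond [leRHS]big_nat_cond; apply: ler_sum => l /andP[/andP[_ li] _].
have lm : (l <= m)%N by apply: leq_trans im; apply: ltnW.
rewrite mulrC; apply: ler_wpM2r; first by rewrite ltW ?binom_mass_gt0.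
by rewrite lerD2l lerN2 ler_nat ltnW.
Qed.

(* The value at [0] is irrelevant (there the division is by 0). *)
Definition stein_solution (h : nat -> R) (i : nat) : R :=
  (\sum_(0 <= l < i) b l * (h l - pgf_expect h (pgf_bern p ^+ m))) /
  (i%:R * (1 - p) * b i).

Lemma pgf_expect_binom h :
  pgf_expect h (pgf_bern p ^+ m) = \sum_(0 <= l < m.+1) b l * h l.
Proof.
rewrite big_mkord (@pgf_expect_widen _ _ _ m.+1) //.
by apply/leq_sizeP => l ml; rewrite -/(b l) binom_massE bin_small.
Qed.

(** By detailed balance both terms on the left have denominator [b j]: they are the centred sums
    with and without the index [j], so a single term remains. *)
Lemma stein_equation h j : (j <= m)%N ->
  (m%:R - j%:R) * p * stein_solution h j.+1 - j%:R * (1 - p) * stein_solution h j =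
  h j - pgf_expect h (pgf_bern p ^+ m).
Proof.
move=> jm; have [p0 p1] := andP p01; have q0 : 0 < 1 - p by rewrite subr_gt0.
rewrite /stein_solution; set H := pgf_expect _ _; set S := fun i => \sum_(0 <= l < i) b l * (h l - H).
have bj := gt_eqF (binom_mass_gt0 jm).
have S0 : j%:R * (1 - p) * (S j / (j%:R * (1 - p) * b j)) = S j / b j.
  case: (posnP j) => [->|j0]; first by rewrite /S big_geq // !mul0r.
  by field; rewrite bj gt_eqF //= pnatr_eq0 -lt0n.
(* The complete centred sum vanishes. This covers [j = m], where the up rate is zero. *)
have Sm : S m.+1 = 0.
  rewrite /S; under eq_bigr do rewrite mulrBr.
  by rewrite sumrB -mulr_suml sum_binom_mass mul1r -pgf_expect_binom subrr.
have S1 : (m%:R - j%:R) * p * (S j.+1 / (j.+1%:R * (1 - p) * b j.+1)) = S j.+1 / b j.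
  have [->|jm'] := eqVneq j m; first by rewrite Sm !mul0r mulr0.
  have jm1 : (j < m)%N by rewrite ltn_neqAle jm'.
  have bj1 := gt_eqF (binom_mass_gt0 jm1).
  have e : (m%:R - j%:R) * p = j.+1%:R * (1 - p) * b j.+1 / b j.
    by rewrite -binom_mass_rec // mulfK ?bj.
  by rewrite e; field; rewrite bj bj1 gt_eqF // nat1r pnatr_eq0.
rewrite -/(S j) -/(S j.+1) S0 // S1 -mulrBl /S big_nat_recr //= addrAC subrr add0r.
by rewrite mulrAC divff ?mul1r // bj.
Qed.
End Binomial.

(** Here [L], [b], [U] stand for the binomial mass below, at and above an index, [a], [e], [c] for
    these masses weighted by [h], and [x], [y] for the up and down rates. With [K = U / x + L / y],
    the increment is linear in [(a, e, c)], with coefficients of signs [-], [+], [-], and vanishes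
    at [(L, b, U)]; hence its extreme values on the box are [K] and [- K]. *)
Lemma stein_increment_bound (R : realFieldType) (a c e L b U x y q p : R) :
  0 <= a <= L -> 0 <= e <= b -> 0 <= c <= U -> 0 < b -> 0 < x -> 0 < y ->
  L + b + U = 1 -> U * (y - x) <= x * b -> L * (x - y) <= y * b ->
  0 < p -> 0 < q -> p + q = 1 ->
  `|(U * (a + e + c) - c) / (x * b) - (a - L * (a + e + c)) / (y * b)| <=
  (q * x + p * y)^-1.
Proof.
move=> /andP[a0 aL] /andP[e0 eb] /andP[c0 cU] b0 x0 y0 LbU Ux Ly p0 q0 pq.
set K := U / x + L / y.
have xu : x != 0 by rewrite gt_eqF.
have yu : y != 0 by rewrite gt_eqF.
have bu : b != 0 by rewrite gt_eqF.
have Ky : K - y^-1 <= 0.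
  have -> : K - y^-1 = (U * (y - x) - x * b) / (x * y).
    by rewrite /K (_ : L = 1 - b - U); [field; rewrite xu yu | rewrite -LbU; ring].
  by rewrite pmulr_lle0 ?invr_gt0 ?mulr_gt0 // subr_le0.
have Kx : K - x^-1 <= 0.
  have -> : K - x^-1 = (L * (x - y) - y * b) / (x * y).
    by rewrite /K (_ : U = 1 - b - L); [field; rewrite xu yu | rewrite -LbU; ring].
  by rewrite pmulr_lle0 ?invr_gt0 ?mulr_gt0 // subr_le0.
have E : (U * (a + e + c) - c) / (x * b) - (a - L * (a + e + c)) / (y * b) =
    (e * K + a * (K - y^-1) + c * (K - x^-1)) / b.
  by rewrite /K; field; rewrite xu yu bu.
have s0 : b * K + L * (K - y^-1) + U * (K - x^-1) = 0.
  rewrite (_ : b = 1 - L - U); last by rewrite -LbU; ring.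
  by rewrite /K; field; rewrite xu yu.
have K0 : 0 <= K by rewrite addr_ge0 // divr_ge0 ?(le_trans a0 aL) ?(le_trans c0 cU) // ltW.
(* The two truncated mean inequalities give [K (q x + p y) <= U + L + b = 1]. *)
apply: (@le_trans _ _ K); last first.
  rewrite -[leRHS]mul1r ler_pdivlMr; last by rewrite addr_gt0 ?mulr_gt0.
  have Uy : U * (y / x) <= U + b.
    by rewrite mulrA ler_pdivrMr // (le_trans _ (_ : U * x + x * b <= _)); lra.
  have Lx : L * (x / y) <= L + b.
    by rewrite mulrA ler_pdivrMr // (le_trans _ (_ : L * y + y * b <= _)); lra.
  have -> : K * (q * x + p * y) = q * U + p * L + p * (U * (y / x)) + q * (L * (x / y)).
    by rewrite /K; field; rewrite xu yu.
  have := ler_wpM2l (ltW p0) Uy; have := ler_wpM2l (ltW q0) Lx.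
  have -> : q = 1 - p by rewrite -pq; ring.
  move: LbU; lra.
rewrite E normrM normfV (gtr0_norm b0) ler_pdivrMr // ler_norml.
have ae : e * K <= b * K by rewrite ler_wpM2r.
have e0K : 0 <= e * K by rewrite mulr_ge0.
have := ler_wnM2r Ky aL; have := ler_wnM2r Kx cU.
have := mulr_ge0_le0 a0 Ky; have := mulr_ge0_le0 c0 Kx.
move: s0 ae e0K; rewrite [K * b]mulrC; lra.
Qed.

Section Stein.
Variables (R : realFieldType).
Implicit Types (h g : nat -> R) (p : R).

Lemma stein_solution_increment m p h i : 0 < p < 1 -> (forall j, 0 <= h j <= 1) ->
  (0 < i < m)%N ->
  `|stein_solution m p h i.+1 - stein_solution m p h i| <= (m%:R * p * (1 - p))^-1.
Proof.
move=> p01 h01 /andP[i0 im]; have [p0 p1] := andP p01.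
have lem := ltnW im.
have b_ge0 l : (l < m.+1)%N -> 0 <= binom_mass m p l by move=> lm; rewrite ltW ?binom_mass_gt0.
pose b := binom_mass m p.
pose L := \sum_(0 <= l < i) b l; pose U := \sum_(i.+1 <= l < m.+1) b l.
pose a := \sum_(0 <= l < i) b l * h l; pose c := \sum_(i.+1 <= l < m.+1) b l * h l.
have split (F : nat -> R) : \sum_(0 <= l < m.+1) F l =
    \sum_(0 <= l < i) F l + F i + \sum_(i.+1 <= l < m.+1) F l.
  by rewrite (@big_cat_nat _ _ _ i.+1) //= big_nat_recr.
have LbU : L + b i + U = 1 by rewrite -split sum_binom_mass.
have HE : pgf_expect h (pgf_bern p ^+ m) = a + b i * h i + c by rewrite pgf_expect_binom split.
have part j k : (k <= m.+1)%N -> 0 <= \sum_(j <= l < k) b l * h l <= \sum_(j <= l < k) b l.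
  move=> km; apply/andP; split.
    rewrite big_nat_cond; apply: sumr_ge0 => l /andP[/andP[_ lk] _]; have /andP[h0 _] := h01 l.
    by rewrite mulr_ge0 // b_ge0 // (leq_trans lk).
  rewrite big_nat_cond [leRHS]big_nat_cond.
  apply: ler_sum => l /andP[/andP[_ lk] _]; have /andP[_ h1] := h01 l.
  by rewrite ler_piMr // b_ge0 // (leq_trans lk).
have bi : 0 < b i by apply: binom_mass_gt0.
have mi : 0 < (m%:R - i%:R) * p by rewrite mulr_gt0 ?subr_gt0 ?ltr_nat.
have q0 : 0 < 1 - p by rewrite subr_gt0.
have iq : 0 < i%:R * (1 - p) by rewrite mulr_gt0 ?ltr0n.
have := @stein_increment_bound R a c (b i * h i) L (b i) U _ _ (1 - p) p
  (part _ _ (leqW lem)) _ (part _ _ (leqnn _)) bi mi iq LbU _ _ p0 q0 _.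
have -> : (1 - p) * ((m%:R - i%:R) * p) + p * (i%:R * (1 - p)) = m%:R * p * (1 - p) by ring.
rewrite -HE; set H := pgf_expect _ _ => bound.
have partH j k : \sum_(j <= l < k) b l * (h l - H) =
    \sum_(j <= l < k) b l * h l - (\sum_(j <= l < k) b l) * H.
  by rewrite mulr_suml -sumrB; apply: eq_bigr => l _; rewrite mulrBr.
have -> : stein_solution m p h i = (a - L * H) / (i%:R * (1 - p) * b i).
  by rewrite /stein_solution -/H partH.
(* As the full centred sum is zero, the numerator at [i.+1] is also minus the sum over the indices
   above [i]; balance expresses the denominator through [b i]. *)
have -> : stein_solution m p h i.+1 = (U * H - c) / ((m%:R - i%:R) * p * b i).
  rewrite /stein_solution -/H binom_mass_rec // -/b; congr (_ / _).
  rewrite partH !big_nat_recr //= -/L -/a.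
  by rewrite (_ : U = 1 - L - b i); [rewrite /H HE; ring | rewrite -LbU; ring].
apply: bound.
- by have /andP[h0 h1] := h01 i; rewrite mulr_ge0 ?ler_piMr // ltW.
- have := binom_upper_mean p01 lem; rewrite -/b -/U.
  by have -> : i%:R * (1 - p) - (m%:R - i%:R) * p = i%:R - m%:R * p by ring.
- have := binom_lower_mean p01 lem; rewrite -/b -/L.
  by have -> : (m%:R - i%:R) * p - i%:R * (1 - p) = m%:R * p - i%:R by ring.
- by rewrite addrC subrK.
Qed.

Variables (I : finType).
Implicit Types (f : I -> R) (P : pred I).

Lemma deriv_pgf_indep P f :
  (pgf_indep P f)^`() = \sum_(i | P i) f i *: pgf_indep (fun j => P j && (j != i)) f.
Proof.
have [n] := ubnP #|P|; elim: n P => // n IH P; rewrite ltnS => cP.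
have [i Pi|P0] := pickP P; last first.
  by rewrite /pgf_indep !big_pred0 // derivC.
rewrite (pgf_indepD1 _ Pi) derivM IH; last first.
  apply: leq_trans cP; apply: proper_card; apply/properP; split.
    by apply/fintype.subsetP => j /andP[].
  by exists i; rewrite // unfold_in eqxx andbF.
rewrite {1}/pgf_bern derivD derivC add0r derivZ derivX alg_polyC mul_polyC.
rewrite [in RHS](bigD1 i) //=; congr (_ + _).
rewrite mulr_sumr; apply: eq_bigr => j /andP[Pj ji].
rewrite -scalerAr; congr (_ *: _); rewrite [RHS](@pgf_indepD1 _ _ _ f i) /=; last first.
  by rewrite Pi eq_sym.
congr (_ * _); apply: eq_bigl => k; rewrite andbAC //.
Qed.

Local Notation minus1 f i := (pgf_indep (fun j => j != i) f).

(** Derivation expands each factor [j] into a sum over single Bernoulli variables. Conditioning on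
    such a variable cancels the terms in [g j.+2] and leaves the factor [p - f i]. *)
Lemma pgf_indep_stein f p g :
  pgf_expect (fun j => (#|I|%:R - j%:R) * p * g j.+1 - j%:R * (1 - p) * g j)
    (pgf_indep xpredT f) =
  \sum_i (p - f i) * pgf_expect (fun j => g j.+1) (minus1 f i).
Proof.
set Q := pgf_indep _ _.
transitivity (p * (#|I|%:R * pgf_expect (fun j => g j.+1) Q) -
    p * pgf_expect (fun j => j%:R * g j.+1) Q -
    (1 - p) * pgf_expect (fun j => j%:R * g j) Q).
  rewrite -!pgf_expectZl -!pgf_expectBl; apply: eq_bigr => j _; ring.
rewrite !pgf_expect_deriv deriv_pgf_indep !pgf_expect_sum.
have [e Ee] : exists e, e = pgf_expect (fun j => g j.+1) Q by eexists.
rewrite -Ee [#|I|%:R * _]mulr_natl -sumr_const !mulr_sumr -!sumrB; apply: eq_bigr => i _.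
rewrite !pgf_expectZ Ee {1}/Q (pgf_indepD1 f (isT : xpredT i)) pgf_expect_bern; ring.
Qed.

Lemma sum_sqr_diff f p : \sum_i f i = #|I|%:R * p ->
  \sum_i \sum_j (f j - f i) ^+ 2 = 2 * #|I|%:R * \sum_i (f i - p) ^+ 2.
Proof.
move=> sf; have s0 : \sum_i (f i - p) = 0 by rewrite sumrB sf sumr_const mulr_natl subrr.
transitivity (\sum_i \sum_j ((f j - p) ^+ 2 + (f i - p) ^+ 2 - 2 * ((f i - p) * (f j - p)))).
  by apply: eq_bigr => i _; apply: eq_bigr => j _; ring.
under eq_bigr => i _ do
  rewrite sumrB big_split /= sumr_const -[X in _ - X]mulr_sumr -[X in _ - _ * X]mulr_sumr s0 mulr0 mulr0 subr0.
by rewrite big_split /= sumr_const sumrMnl -mulr_natl; ring.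
Qed.

(** Since the deviations from the mean sum to zero, [2 #|I|] times the sum on the left is the double
    sum of [(f j - f i) (e i - e j)], in which only differences of [e] occur. *)
Lemma antisym_sum_le f p (e : I -> R) D : \sum_i f i = #|I|%:R * p ->
  (forall i j, `|e i - e j| <= D * `|f j - f i|) ->
  `|\sum_i (p - f i) * e i| <= D * \sum_i (f i - p) ^+ 2.
Proof.
move=> sf eD.
have [I0|I0] := posnP #|I|.
  by rewrite !big_pred0 ?mulr0 ?normr0 // => i; move: (card0_eq I0 i); rewrite inE.
have n0 : 0 < 2 * #|I|%:R :> R by rewrite mulr_gt0 ?ltr0n.
have E : 2 * #|I|%:R * \sum_i (p - f i) * e i =
    \sum_i \sum_j (f j - f i) * (e i - e j).
  have E1 : \sum_i \sum_j (f j - f i) * e i = #|I|%:R * \sum_i (p - f i) * e i.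
    rewrite mulr_sumr; apply: eq_bigr => i _.
    by rewrite -mulr_suml sumrB sf sumr_const -mulr_natl; ring.
  have E2 : \sum_i \sum_j (f j - f i) * e j = - \sum_i \sum_j (f j - f i) * e i.
    rewrite exchange_big /= -sumrN; apply: eq_bigr => i _; rewrite -sumrN.
    by apply: eq_bigr => j _; ring.
  transitivity (\sum_i (\sum_j (f j - f i) * e i - \sum_j (f j - f i) * e j)).
    by rewrite sumrB E2 E1; ring.
  by apply: eq_bigr => i _; rewrite -sumrB; apply: eq_bigr => j _; ring.
rewrite -(ler_pM2l n0) -[X in X * `|_|](ger0_norm (ltW n0)) -normrM E.
apply: le_trans (ler_norm_sum _ _ _) _.
have -> : 2 * #|I|%:R * (D * \sum_i (f i - p) ^+ 2) = D * \sum_i \sum_j (f j - f i) ^+ 2.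
  by rewrite (sum_sqr_diff sf); ring.
rewrite mulr_sumr; apply: ler_sum => i _; apply: le_trans (ler_norm_sum _ _ _) _.
rewrite mulr_sumr; apply: ler_sum => j _.
by rewrite normrM -[X in D * X]real_normK ?num_real // expr2 mulrA mulrC ler_wpM2r.
Qed.

(** Taking the expectation of the Stein equation under the law of the sum expresses the error
    through leave-one-out sums. Leaving out [i] rather than [j] changes the expectation by
    [f j - f i] times an expected increment of the Stein solution. *)
Lemma pgf_indep_binomial_stein h f p : 0 < p < 1 ->
  (forall j, 0 <= h j <= 1) -> (forall i, 0 <= f i <= 1) -> \sum_i f i = #|I|%:R * p ->
  `|pgf_expect h (pgf_indep xpredT f) - pgf_expect h (pgf_bern p ^+ #|I|)| <=
  (#|I|%:R * p * (1 - p))^-1 * \sum_i (f i - p) ^+ 2.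
Proof.
move=> p01 h01 f01 sf; set H := pgf_expect h (_ ^+ _).
pose g := stein_solution #|I| p h.
have -> : pgf_expect h (pgf_indep xpredT f) - H =
    \sum_i (p - f i) * pgf_expect (fun j => g j.+1) (minus1 f i).
  rewrite -pgf_indep_stein -[H]mulr1 -{1}(pgf_indep1 xpredT f) -pgf_expect_cst -pgf_expectBl.
  have sQ : (size (pgf_indep xpredT f) <= #|I|.+1)%N by apply: size_pgf_indep.
  apply: eq_bigr => j _; congr (_ * _); rewrite stein_equation //.
  by rewrite -ltnS (leq_trans (ltn_ord j)).
apply: antisym_sum_le => // i j; have [->|ij] := eqVneq i j.
  by rewrite !subrr normr0 mulr0.
pose Q := pgf_indep (fun k => (k != i) && (k != j)) f.
have Qi : minus1 f i = pgf_bern (f j) * Q by rewrite (@pgf_indepD1 _ _ _ f j) // eq_sym.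
have Qj : minus1 f j = pgf_bern (f i) * Q.
  by rewrite (@pgf_indepD1 _ _ _ f i) //; congr (_ * _); apply: eq_bigl => k; rewrite andbC.
have -> : pgf_expect (fun k => g k.+1) (minus1 f i) - pgf_expect (fun k => g k.+1) (minus1 f j) =
    (f j - f i) * pgf_expect (fun k => g k.+2 - g k.+1) Q.
  by rewrite Qi Qj !pgf_expect_bern pgf_expectBl; ring.
rewrite normrM mulrC ler_wpM2r //.
(* The sum without [i] and [j] is at most [#|I| - 2], so increments of [g] occur only at indices
   strictly between [0] and [#|I|]. *)
have cQ : (#|(fun k => (k != i) && (k != j)) : pred I|.+2 = #|I|)%N.
  rewrite [RHS](cardD1 i) [in RHS](cardD1 j) !inE /= eq_sym ij !add1n; congr _.+2.
  by apply: eq_card => k; rewrite !inE /= andbT andbC.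
have sQ := size_pgf_indep (fun k => (k != i) && (k != j)) f.
apply: (pgf_expect_norm_le sQ) => [k||k kI].
- exact: coef_pgf_indep_ge0.
- exact: pgf_indep1.
- by apply: stein_solution_increment => //=; rewrite -cQ !ltnS.
Qed.
End Stein.

(** This is [min (1/2) (1 / (m t))] when [m t > 0]. Written as the inverse of a maximum, it is also
    defined, continuous and nonincreasing across [t = 0]. *)
Definition tail_bound (R : realFieldType) (m : nat) (t : R) : R :=
  (Num.max 2 (m%:R * t))^-1.

(** * Combination of the averaging bound and the Stein bound *)

Section TailBound.
Variables (R : realFieldType) (m : nat).
Hypothesis m_gt0 : (0 < m)%N.
Implicit Types (t p : R).

Lemma tail_bound_ge0 t : 0 <= tail_bound m t.
Proof. by rewrite invr_ge0 le_max ler0n. Qed.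

Lemma tail_bound_le_half t : tail_bound m t <= 2^-1.
Proof. by rewrite lef_pV2 ?posrE ?lt_max ?ltr0n // le_max lexx. Qed.

Lemma tail_bound_nonincreasing t p : t <= p -> tail_bound m p <= tail_bound m t.
Proof.
move=> tp; rewrite lef_pV2 ?posrE ?lt_max ?ltr0n // ge_max le_max lexx /=.
by rewrite le_max ler_wpM2l ?ler0n // orbT.
Qed.

(** If [m p] or [m (1 - p)] is at most [2], one of the tail terms equals [1/2] and the averaging
    bound suffices; otherwise they add up to the Stein factor [1 / (m p (1 - p))]. *)
Lemma pgf_indep_binomial (I : finType) (h : nat -> R) (f : I -> R) p : #|I| = m ->
  (forall j, 0 <= h j <= 1) -> (forall j, `|h j.+2 - 2 * h j.+1 + h j| <= 1) ->
  (forall i, 0 <= f i <= 1) -> \sum_i f i = m%:R * p ->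
  `|pgf_expect h (pgf_indep xpredT f) - pgf_expect h (pgf_bern p ^+ m)| <=
  (tail_bound m p + tail_bound m (1 - p)) * \sum_i (f i - p) ^+ 2.
Proof.
move=> Im h01 h2 f01; rewrite -Im => sf.
have S0 : 0 <= \sum_i (f i - p) ^+ 2 by apply: sumr_ge0 => i _; apply: sqr_ge0.
have half : `|pgf_expect h (pgf_indep xpredT f) - pgf_expect h (pgf_bern p ^+ #|I|)| <=
    2^-1 * \sum_i (f i - p) ^+ 2.
  by rewrite -prodr_const; apply: pgf_indep_binomial_half.
have t1 := tail_bound_ge0 p; have t2 := tail_bound_ge0 (1 - p).
rewrite Im in sf half *.
have [pm|pm] := leP (m%:R * p) 2.
  apply: le_trans half _; rewrite ler_wpM2r // {1}/tail_bound max_l //; lra.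
have [qm|qm] := leP (m%:R * (1 - p)) 2.
  apply: le_trans half _; rewrite ler_wpM2r // {2}/tail_bound max_l //; lra.
have m0 : 0 < m%:R :> R by rewrite ltr0n.
have p0 : 0 < p by rewrite -(pmulr_rgt0 _ m0) (le_lt_trans _ pm).
have q0 : 0 < 1 - p by rewrite -(pmulr_rgt0 _ m0) (le_lt_trans _ qm).
have p01 : 0 < p < 1 by rewrite p0 -subr_gt0.
have -> : tail_bound m p + tail_bound m (1 - p) = (m%:R * p * (1 - p))^-1.
  by rewrite /tail_bound !max_r ?ltW //; field; rewrite !gt_eqF.
by rewrite -Im; apply: pgf_indep_binomial_stein => //; rewrite Im.
Qed.
End TailBound.

(** * Monotonicity of the binomial law in its parameter *)

Section BinomialCdf.
Variable R : realFieldType.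
Implicit Types (h : nat -> R) (p q : R).

Lemma pgf_bern_exp_indep m p : pgf_bern p ^+ m = pgf_indep xpredT (fun _ : 'I_m => p).
Proof. by rewrite /pgf_indep prodr_const card_ord. Qed.

Lemma pgf_expect_exp_le h1 h2 m p : 0 <= p <= 1 -> (forall j, h1 j <= h2 j) ->
  pgf_expect h1 (pgf_bern p ^+ m) <= pgf_expect h2 (pgf_bern p ^+ m).
Proof.
move=> p01 hh; apply: (pgf_expect_le (leqnn _)) => // j.
by rewrite pgf_bern_exp_indep; apply: coef_pgf_indep_ge0.
Qed.

Lemma pgf_expect_exp_nonincreasing h m p q : (forall j, h j.+1 <= h j) ->
  0 <= p -> p <= q -> q <= 1 ->
  pgf_expect h (pgf_bern q ^+ m) <= pgf_expect h (pgf_bern p ^+ m).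
Proof.
move=> + p0 pq q1; elim: m h => [|m IH] h hS; first by rewrite !expr0.
rewrite !exprS !pgf_expect_bern.
have := IH h hS; have := IH (fun j => h j.+1) (fun j => hS j.+1).
have : pgf_expect (fun j => h j.+1) (pgf_bern q ^+ m) <= pgf_expect h (pgf_bern q ^+ m).
  by apply: pgf_expect_exp_le => //; rewrite (le_trans p0 pq).
set a := pgf_expect _ _; set b := pgf_expect _ _; set c := pgf_expect _ _.
set d := pgf_expect _ _ => ab ac bd.
(* Conditioning on one trial, the difference of the two sides is the sum of these three nonnegative
   products. *)
have := mulr_ge0 (_ : 0 <= q - p) (_ : 0 <= b - a).
have := mulr_ge0 (_ : 0 <= 1 - p) (_ : 0 <= d - b).
have := mulr_ge0 p0 (_ : 0 <= c - a).
rewrite !subr_ge0 => /(_ ac) h1 /(_ (le_trans pq q1) bd) h2 /(_ pq ab) h3; lra.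
Qed.
End BinomialCdf.

Local Open Scope classical_set_scope.
Local Open Scope ring_scope.

(** * Independence and counts of scores *)

Section Decoupling.
Context d (T : measurableType d) (R : realType) (P : probability T R).
Variables (I : finType) (Z : I -> {RV P >-> R}) (i0 : I).
Hypothesis Z_indep : mutually_independent Z.

(** A pi-system generating the sigma-algebra of the scores other than [i0]. The outcome [w], seen
    through this smaller sigma-algebra, plays the role of the vector of these scores. *)
Definition others_cylinder : set (set T) :=
  [set A | exists B : I -> set R, (forall i, measurable (B i)) /\
    A = \bigcap_(i in [set i | i != i0]) Z i @^-1` B i].

Local Notation S := (g_sigma_algebraType others_cylinder).

Let setI_closed_cylinder : setI_closed others_cylinder.
Proof.
move=> _ _ [B [mB ->]] [B' [mB' ->]]; exists (fun i => B i `&` B' i); split.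
  by move=> i; apply: measurableI.
apply/seteqP; split => [w [BZ BZ'] i ii0|w BZ].
  by split; [exact: BZ|exact: BZ'].
by split => i /BZ [].
Qed.

Let cylinderT : others_cylinder setT.
Proof.
exists (fun=> setT); split => //.
by apply/seteqP; split => // w _ i _.
Qed.

Let measurable_cylinder : others_cylinder `<=` measurable.
Proof.
move=> _ [B [mB ->]]; apply: fin_bigcap_measurable => [|i _]; first exact: finite_finset.
by rewrite -[X in measurable X]setTI; apply: measurable_funPT.
Qed.

Let measurable_others (A : set T) : measurable (A : set S) -> measurable A.
Proof. exact: (smallest_sub (@sigma_algebra_measurable _ T) measurable_cylinder). Qed.

Let measurable_id_others : measurable_fun setT (id : T -> S).
Proof. by move=> _ A mA; rewrite setTI; apply: measurable_others. Qed.

Let measurable_fun_others i : i != i0 -> measurable_fun setT (Z i : S -> R).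
Proof.
move=> ii0 _ A mA; rewrite setTI; apply: sub_sigma_algebra.
exists (fun j => if j == i then A else setT); split.
  by move=> j; case: ifP.
apply/seteqP; split => [w ZA j _ /=|w /(_ i ii0)]; last by rewrite /= eqxx.
by case: eqVneq => // ->.
Qed.

Let indep_cylinder A B : others_cylinder A -> measurable B ->
  P (A `&` Z i0 @^-1` B) = (P A * P (Z i0 @^-1` B))%E.
Proof.
move=> [C [mC ->]] mB.
pose C' i := if i == i0 then B else C i.
have mC' i : measurable (C' i) by rewrite /C'; case: ifP.
have e1 := Z_indep (J := (~: [set i0])%SET) (B := C) (fun i _ => mC i).
have e2 := Z_indep (J := [set: I]%SET) (B := C') (fun i _ => mC' i).
have -> : [set i | i != i0] = [set` (~: [set i0])%SET].
  by apply/seteqP; split => i /=; rewrite !inE.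
have -> : \bigcap_(i in [set` (~: [set i0])%SET]) Z i @^-1` C i `&` Z i0 @^-1` B =
    \bigcap_(i in [set` [set: I]%SET]) Z i @^-1` C' i.
  apply/seteqP; split => [w [CZ BZ] i _ /=|w CZ].
    rewrite /C'; case: eqVneq => [-> //|ii0]; apply: CZ => /=.
    by rewrite !inE.
  split; last by have := CZ i0; rewrite /= /C' eqxx; apply; rewrite inE.
  move=> i /=; rewrite !inE => ii0.
  by have := CZ i; rewrite /= /C' (negPf ii0); apply; rewrite inE.
rewrite e1 e2.
rewrite (bigD1 i0) //= /C' eqxx muleC; congr (_ * _)%E.
apply: eq_big => [i|i /andP[_ ii0]]; first by rewrite !inE.
by rewrite (negPf ii0).
Qed.

(** Both sides are finite measures in [A], namely [P] restricted to the event on [Z i0] and [P]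
    scaled by its probability; they agree on the generating pi-system. *)
Let indep_others A B : measurable (A : set S) -> measurable B ->
  P (A `&` Z i0 @^-1` B) = (P A * P (Z i0 @^-1` B))%E.
Proof.
move=> mA mB.
have mD : measurable (Z i0 @^-1` B).
  by rewrite -[X in measurable X]setTI; apply: measurable_funPT.
have c0 : 0 <= fine (P (Z i0 @^-1` B)) by rewrite fine_ge0.
pose mR0 : {measure set S -> \bar R} := pushforward (mrestr P mD) (id : T -> S).
pose mR := mR0 measurable_id_others.
pose mS0 : {measure set S -> \bar R} := pushforward (mscale (NngNum c0) P) (id : T -> S).
pose mS := mS0 measurable_id_others.
have cE : (fine (P (Z i0 @^-1` B)))%:E = P (Z i0 @^-1` B) by rewrite fineK ?fin_num_measure.
have mRE (C : set T) : mR C = P (C `&` Z i0 @^-1` B) by [].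
have mSE (C : set T) : mS C = (P C * P (Z i0 @^-1` B))%E.
  by rewrite /mS /= /pushforward /mscale /= cE muleC.
rewrite -mRE -mSE.
apply: (@measure_unique _ R S others_cylinder (fun=> setT)) => //.
- by rewrite bigcup_const //; exists 0%N.
- by move=> C GC; rewrite mRE mSE indep_cylinder.
- move=> _; rewrite mRE; apply: le_lt_trans (ltry 1); apply: probability_le1.
  exact: measurableI.
Qed.

(** The law of [(w, Z i0 w)] on the product of the smaller sigma-algebra with the Borel sets is a
    product measure; integrating its sections in either order gives the two formulas. *)
Lemma decoupling (E : set (S * R)) : measurable E ->
  P [set w | E (w, Z i0 w)] = (\int[P]_w P [set w' | E (w, Z i0 w')])%E /\
  P [set w | E (w, Z i0 w)] = (\int[P]_w P [set w' | E (w', Z i0 w)])%E.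
Proof.
move=> mE.
pose Xmf : {mfun T >-> S} := mfun_Sub (mem_set measurable_id_others).
pose mX := distribution P Xmf.
pose mV := distribution P (Z i0).
pose pr : T -> S * R := fun w => (w, Z i0 w).
have mpair : measurable_fun setT pr by apply: measurable_fun_pair.
pose J0 : {measure set (S * R) -> \bar R} := pushforward P pr.
pose J := J0 mpair.
have JE A B : measurable A -> measurable B -> J (A `*` B) = (mX A * mV B)%E.
  move=> mA mB; rewrite /mX /mV /distribution /pushforward /= -indep_others //.
have PE : P [set w | E (w, Z i0 w)] = J E by [].
have JX := product_measure_unique JE mE.
have JX2 : (mX \x^ mV)%E E = (mX \x mV)%E E.
  by apply/esym/product_measure_unique => //= ? ? ? ?; rewrite product_measure2E.
split.
  rewrite PE -JX /product_measure1 ge0_integral_distribution //.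
    apply: eq_integral => w _ /=; rewrite /mV /distribution /pushforward.
    by congr (P _); apply/seteqP; split => w' /=; rewrite /xsection /= inE.
  exact: measurable_fun_xsection.
rewrite PE -JX -JX2 /product_measure2 ge0_integral_distribution //.
  apply: eq_integral => w _ /=; rewrite /mX /distribution /pushforward.
  by congr (P _); apply/seteqP; split => w' /=; rewrite /ysection /= inE.
exact: measurable_fun_ysection.
Qed.

(* [count_below J w z] counts the scores indexed by [J] that are below [z]. *)
Definition count_below (J : pred I) (w : T) (z : R) : nat :=
  #|[pred i | J i && (Z i w < z)]|.

Lemma measurable_count_others (J : pred I) n : ~~ J i0 ->
  measurable ([set p | n <= count_below J p.1 p.2]%N : set (S * R)).
Proof.
move=> Ji0.
pose f (p : S * R) : R := \sum_i (if J i && (Z i p.1 < p.2) then 1 else 0).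
have fE p : f p = (count_below J p.1 p.2)%:R.
  rewrite /count_below -sum1_card natr_sum /f [in RHS]big_mkcond /=.
  by apply: eq_bigr => i _; rewrite inE; case: ifP.
have mf : measurable_fun setT f.
  apply: measurable_sum => i; have [Ji|nJi] := boolP (J i); last exact: measurable_cst.
  have ii0 : i != i0 by apply: contraTneq Ji => ->.
  apply: measurable_fun_ifT => //; apply: measurable_fun_ltr => //.
  exact: (measurableT_comp (measurable_fun_others ii0)).
have -> : [set p | n <= count_below J p.1 p.2]%N = f @^-1` `[n%:R, +oo[.
  by apply/seteqP; split => p /=; rewrite in_itv /= andbT fE ler_nat.
by rewrite -[X in measurable X]setTI; apply: mf.
Qed.

Lemma measurable_count_others_section (J : pred I) n z : ~~ J i0 ->
  measurable ([set w | n <= count_below J w z]%N : set S).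
Proof.
move=> Ji0; have := measurable_ysection z (measurable_count_others n Ji0).
by congr measurable; apply/seteqP; split => w /=; rewrite /ysection /= inE.
Qed.

Lemma decoupling_count (J : pred I) n : ~~ J i0 ->
  let E w z := (n <= count_below J w z)%N in
  P [set w | E w (Z i0 w)] = (\int[P]_w P [set w' | E w (Z i0 w')])%E /\
  P [set w | E w (Z i0 w)] = (\int[P]_w P [set w' | E w' (Z i0 w)])%E.
Proof. by move=> Ji0 E; apply: (decoupling (measurable_count_others n Ji0)). Qed.

Lemma measurable_decoupled (J : pred I) n : ~~ J i0 ->
  measurable_fun setT (fun w => P [set w' | n <= count_below J w (Z i0 w')]%N).
Proof.
move=> Ji0; pose mV := distribution P (Z i0).
have mS := measurable_fun_xsection mV (measurable_count_others n Ji0).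
have := measurableT_comp mS measurable_id_others.
congr measurable_fun; apply/funext => w /=; rewrite /mV /distribution /pushforward.
by congr (P _); apply/seteqP; split => w' /=; rewrite /xsection /= inE.
Qed.

Lemma indep_count_below (J : pred I) n z B : ~~ J i0 -> measurable B ->
  P ([set w | n <= count_below J w z]%N `&` Z i0 @^-1` B) =
  (P [set w | n <= count_below J w z]%N * P (Z i0 @^-1` B))%E.
Proof. by move=> Ji0 mB; apply: indep_others => //; apply: measurable_count_others_section. Qed.

Lemma measurable_count_below (J : pred I) n z : ~~ J i0 ->
  measurable [set w | n <= count_below J w z]%N.
Proof. by move=> Ji0; apply: measurable_others; apply: measurable_count_others_section. Qed.
End Decoupling.

(** * Law of the number of scores below a fixed level *)

Section CountLaw.
Context d (T : measurableType d) (R : realType) (P : probability T R).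
Variables (I : finType) (Z : I -> {RV P >-> R}).
Hypothesis Z_indep : mutually_independent Z.

Lemma count_belowD1 (J : pred I) i w z : J i ->
  count_below Z J w z = ((Z i w < z)%R + count_below Z (fun j => J j && (j != i)) w z)%N.
Proof.
move=> Ji; rewrite /count_below (cardD1 i) !inE Ji /=; congr (_ + _)%N.
by apply: eq_card => j; rewrite !inE andbCA andbA.
Qed.

Lemma measurable_below i z : measurable [set w | Z i w < z].
Proof.
have -> : [set w | Z i w < z] = Z i @^-1` `]-oo, z[.
  by apply/seteqP; split => w /=; rewrite in_itv.
by rewrite -[X in measurable X]setTI; apply: measurable_funPT.
Qed.

Lemma measurable_count_at_score (J : pred I) n i :
  measurable [set w | n <= count_below Z J w (Z i w)]%N.
Proof.
pose f w : R := \sum_j (if J j && (Z j w < Z i w) then 1 else 0).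
have fE w : f w = (count_below Z J w (Z i w))%:R.
  rewrite /count_below -sum1_card natr_sum /f [in RHS]big_mkcond /=.
  by apply: eq_bigr => j _; rewrite inE; case: ifP.
have mf : measurable_fun setT f.
  apply: measurable_sum => j; have [Jj|nJj] := boolP (J j); last exact: measurable_cst.
  by apply: measurable_fun_ifT => //; apply: measurable_fun_ltr.
have -> : [set w | n <= count_below Z J w (Z i w)]%N = f @^-1` `[n%:R, +oo[.
  by apply/seteqP; split => w /=; rewrite in_itv /= andbT fE ler_nat.
by rewrite -[X in measurable X]setTI; apply: mf.
Qed.

(** Induction on the size of [J]: whether one score lies below [z] is independent of the count of
    the others, so it contributes one Bernoulli factor. *)
Lemma prob_count_below (J : pred I) z n :
  P [set w | n <= count_below Z J w z]%N =
  (pgf_expect (fun j => (n <= j)%:R)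
     (pgf_indep J (fun i => fine (P [set w | Z i w < z]))))%:E.
Proof.
have [k] := ubnP #|J|; elim: k J n => // k IH J n; rewrite ltnS => cJ.
have [i Ji|J0] := pickP J; last first.
  have c0 w : count_below Z J w z = 0%N.
    by rewrite /count_below eq_card0 // => i; rewrite !inE J0.
  rewrite /pgf_indep big_pred0 // -(expr0 'X) pgf_expect_Xn.
  case: n => [|n].
    by rewrite (_ : [set _ | _] = setT) ?probability_setT //; apply/seteqP.
  by rewrite (_ : [set _ | _] = set0) ?measure0 //; apply/seteqP; split => // w /=; rewrite c0.
pose J' j := J j && (j != i).
have J'i : ~~ J' i by rewrite /J' eqxx andbF.
have cJ' : (#|J'| < k)%N.
  apply: leq_trans cJ; apply: proper_card; apply/properP; split.
    by apply/fintype.subsetP => j /andP[].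
  by exists i; rewrite // unfold_in eqxx andbF.
set f := fun i => fine (P [set w | Z i w < z]).
have mlt := measurable_below i z.
have pE : P [set w | Z i w < z] = (f i)%:E by rewrite fineK ?fin_num_measure.
have qE : P (~` [set w | Z i w < z]) = (1 - f i)%:E.
  by rewrite probability_setC // pE.
(* For [n = 0] the truncated predecessor is again [0] and both count conditions hold trivially. *)
have split_event : [set w | n <= count_below Z J w z]%N =
    ([set w | n <= count_below Z J' w z]%N `&` ~` [set w | Z i w < z]) `|`
    ([set w | n.-1 <= count_below Z J' w z]%N `&` [set w | Z i w < z]).
  apply/seteqP; split => w /=; rewrite (count_belowD1 _ _ Ji) -/J'.
    case: (Z i w < z) => h; [right|left]; split => //.
    by move: h; rewrite add1n; case: n.
  by case=> -[]; case: (Z i w < z) => //; case: n => // n; rewrite add1n.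
have ltE : [set w | Z i w < z] = Z i @^-1` `]-oo, z[.
  by apply/seteqP; split => w /=; rewrite in_itv.
have m1 k' : measurable [set w | k' <= count_below Z J' w z]%N.
  exact: (measurable_count_below Z _ _ J'i).
have ltC : ~` [set w | Z i w < z] = Z i @^-1` (~` `]-oo, z[) by rewrite -preimage_setC -ltE.
have mC : measurable (~` `]-oo, z[ : set R) by apply: measurableC.
have e1 : P ([set w | n <= count_below Z J' w z]%N `&` ~` [set w | Z i w < z]) =
    (P [set w | n <= count_below Z J' w z]%N * (1 - f i)%:E)%E.
  by rewrite -qE ltC (indep_count_below Z_indep _ _ J'i).
have e2 : P ([set w | n.-1 <= count_below Z J' w z]%N `&` [set w | Z i w < z]) =
    (P [set w | n.-1 <= count_below Z J' w z]%N * (f i)%:E)%E.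
  by rewrite -pE ltE (indep_count_below Z_indep _ _ J'i).
rewrite split_event measureU; last 3 first.
- by apply: measurableI => //; apply: measurableC.
- exact: measurableI.
- by rewrite setIACA setICl setI0.
rewrite [LHS](f_equal2 adde e1 e2) -[LHS]/(_ * _ + _ * _)%E.
rewrite !IH // -!EFinM -EFinD; congr EFin.
rewrite (pgf_indepD1 _ Ji) pgf_expect_bern -/J' -/f mulrC; congr (_ + _).
rewrite mulrC; congr (_ * _); apply: eq_bigr => j _; congr (_ * _).
by case: (n).
Qed.
End CountLaw.

(** * Kolmogorov-Smirnov distance and monotone expectations *)

Section TailComparison.
Context d d' (T : measurableType d) (T' : measurableType d') (R : realType).
Variables (P : probability T R) (Q : probability T' R).

(** Layer-cake formula, cut at [c] because the tail vanishes beyond. *)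
Lemma ge0_integral_ccdf_bounded d0 (T0 : measurableType d0) (P0 : probability T0 R)
    (f : T0 -> R) c : measurable_fun setT f -> (forall w, 0 <= f w <= c) ->
  (\int[P0]_w (f w)%:E =
   \int[lebesgue_measure]_(r in `[0%R, c]) P0 [set w | (r < f w)%R])%E.
Proof.
move=> mf f0c; pose X : {RV P0 >-> R} := mfun_Sub (mem_set mf).
have := @ge0_expectation_ccdf _ _ _ P0 X (fun w => proj1 (andP (f0c w))).
rewrite expectation_def /= => ->.
have ccE r : ccdf X r = P0 [set w | r < f w].
  by rewrite /ccdf /distribution /pushforward; congr (P0 _);
    apply/seteqP; split => w /=; rewrite in_itv /= andbT.
rewrite integral_mkcond [RHS]integral_mkcond; apply: eq_integral => r _.
rewrite !patchE ccE; have [r0|r0] := boolP (r \in (`[0, +oo[%classic : set R)).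
  have [//|rc] := boolP (r \in (`[0, c]%classic : set R)).
  rewrite (_ : [set _ | _] = set0) ?measure0 //; apply/seteqP; split => // w /= rw.
  move: rc r0; rewrite !notin_setE !inE /= !in_itv /= andbT => rc r0; apply: rc.
  by rewrite r0 (le_trans (ltW rw)) //; have /andP[] := f0c w.
have [rc|//] := boolP (r \in (`[0, c]%classic : set R)).
by move: rc r0; rewrite !notin_setE !inE /= !in_itv /= andbT => /andP[].
Qed.

(** An error [k] in every tail costs [c * k], since the layer-cake integral runs over an interval of
    length [c]. *)
Lemma ge0_integral_le_tail (f : T -> R) (g : T' -> R) (c k : R) :
  measurable_fun setT f -> measurable_fun setT g -> 0 <= c -> 0 <= k ->
  (forall w, 0 <= f w <= c) -> (forall w, 0 <= g w <= c) ->
  (forall r, P [set w | (r < f w)%R] <= Q [set w | (r < g w)%R] + k%:E)%E ->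
  (\int[P]_w (f w)%:E <= \int[Q]_w (g w)%:E + (c * k)%:E)%E.
Proof.
move=> mf mg c0 k0 f0c g0c tail.
rewrite (ge0_integral_ccdf_bounded P mf f0c) (ge0_integral_ccdf_bounded Q mg g0c).
have mtail d0 (T0 : measurableType d0) (P0 : probability T0 R) (h : T0 -> R) :
    measurable_fun setT h -> measurable_fun [set: R] ((fun r => P0 [set w | r < h w]) : R -> \bar R).
  move=> mh; pose X : {RV P0 >-> R} := mfun_Sub (mem_set mh).
  have := ccdf_measurable X; congr measurable_fun; apply/funext => r.
  by rewrite /ccdf /distribution /pushforward; congr (P0 _);
    apply/seteqP; split => w /=; rewrite in_itv /= andbT.
have -> : (c * k)%:E = (\int[lebesgue_measure]_(r in `[0%R, c]) k%:E)%E.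
  rewrite integral_cst //= lebesgue_measure_itv /= lte_fin.
  case: ltgtP c0 => // [c0|<-] _; last by rewrite mule0 mul0r.
  by rewrite -EFinB -EFinM subr0 mulrC.
rewrite -ge0_integralD //; last exact: measurable_funTS (mtail _ _ Q _ mg).
apply: ge0_le_integral => //.
- exact: measurable_funTS (mtail _ _ P _ mf).
- by apply: emeasurable_funD => //; exact: measurable_funTS (mtail _ _ Q _ mg).
Qed.

End TailComparison.

(** * Half-lines and monotone subsets of the real line *)

Section HalfLines.
Context (R : realType).
Variables (mu nu : probability (measurableTypeR R) R) (k : R).

(** A lower set that is neither empty nor everything is bounded above, and is closed or open
    according to whether it contains its supremum. *)
Lemma lower_set_half_line (D : set R) : (forall x y, x <= y -> D y -> D x) ->
  [\/ D = set0, D = setT, exists a, D = `]-oo, a]%classic | exists a, D = `]-oo, a[%classic].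
Proof.
move=> Ddown; have [->|/set0P D0] := eqVneq D set0; first exact: Or41.
have [->|DT] := eqVneq D setT; first exact: Or42.
have /existsNP[y Dy] : ~ forall y, D y.
  by move=> DA; move/eqP: DT; apply; apply/seteqP; split.
have Dsup : has_sup D.
  split=> //; exists y => x Dx; rewrite leNgt; apply/negP => yx; apply: Dy.
  exact: Ddown (ltW yx) Dx.
have below x : x < sup D -> D x.
  move=> xs; have e0 : 0 < sup D - x by rewrite subr_gt0.
  by have [z Dz] := sup_adherent e0 Dsup; rewrite subKr => xz; exact: Ddown (ltW xz) Dz.
have above x : D x -> x <= sup D by move=> Dx; apply: ub_le_sup => //; case: Dsup.
have [Ds|nDs] := pselect (D (sup D)).
  apply: Or43; exists (sup D); apply/seteqP; split => x /=; rewrite in_itv /=; first exact: above.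
  by move=> xs; exact: Ddown xs Ds.
apply: Or44; exists (sup D); apply/seteqP; split => x /=; rewrite in_itv /=; last exact: below.
move=> Dx; rewrite lt_neqAle above // andbT; apply: contra_notN nDs => /eqP <-.
exact: Dx.
Qed.

(** Continuity from below along the closed half-lines ending at [a - 1 / (n + 1)]. *)
Lemma prob_open_half_line_le (b : \bar R) (a : R) :
  (forall t, t < a -> (mu `]-oo, t]%classic <= b)%E) -> (mu `]-oo, a[%classic <= b)%E.
Proof.
move=> mub; pose F n : set R := `]-oo, (a - n.+1%:R^-1)%R]%classic.
have UF : \bigcup_n F n = `]-oo, a[%classic.
  apply/seteqP; split => [x [n _]|x]; rewrite /F /= !in_itv /=.
    by move=> /le_lt_trans; apply; rewrite ltrBlDr ltrDl invr_gt0 ltr0n.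
  by move=> /ltr_add_invr[n xn]; exists n; rewrite //= in_itv /= lerBrDr ltW.
have Fmono : {homo F : n m / (n <= m)%N >-> (n <= m)%O}.
  move=> n m nm; apply/subsetPset => x; rewrite /F /= !in_itv /= => /le_trans; apply.
  by rewrite lerD2l lerN2 lef_pV2 ?posrE ?ltr0n // ler_nat.
have mU : measurable (\bigcup_n F n) by rewrite UF.
have cF := nondecreasing_cvg_mu (mu := mu) (fun n => measurable_itv _) mU Fmono.
rewrite -UF -(cvg_lim _ cF) //; apply: lime_le; first by apply/cvg_ex; eexists; exact: cF.
apply: nearW => n; apply: mub.
by rewrite ltrBlDr ltrDl invr_gt0 ltr0n.
Qed.

Hypothesis k0 : 0 <= k.
Hypothesis half_line_le : forall t, (mu `]-oo, t]%classic <= nu `]-oo, t]%classic + k%:E)%E.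

Lemma prob_lower_set_le (D : set R) : (forall x y, x <= y -> D y -> D x) ->
  (mu D <= nu D + k%:E)%E.
Proof.
case/lower_set_half_line => [->|->|[a ->]|[a ->]] //.
- by rewrite !measure0 add0e lee_fin.
- by rewrite !probability_setT -EFinD lee_fin lerDl.
- apply: prob_open_half_line_le => t ta; apply: le_trans (half_line_le t) _.
  rewrite leeD2r //; apply: le_measure; rewrite ?inE //.
  by move=> x; rewrite /= !in_itv /= => /le_lt_trans; apply.
Qed.

Lemma measurable_lower_set (D : set R) : (forall x y, x <= y -> D y -> D x) -> measurable D.
Proof. by case/lower_set_half_line => [->|->|[a ->]|[a ->]]. Qed.

(** Passing to complements turns upper sets into lower sets and exchanges [mu] and [nu]. *)
Lemma prob_upper_set_le (D : set R) : (forall x y, x <= y -> D x -> D y) ->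
  (nu D <= mu D + k%:E)%E.
Proof.
move=> Dup; have Dc x y : x <= y -> (~` D) y -> (~` D) x.
  by move=> xy; apply: contra_not; apply: Dup.
have mD : measurable D by rewrite -[D]setCK; apply: measurableC; exact: measurable_lower_set.
have := prob_lower_set_le Dc; rewrite !probability_setC //.
rewrite -(@fineK _ (mu D)) ?fin_num_measure // -(@fineK _ (nu D)) ?fin_num_measure //.
by rewrite -!EFinB -!EFinD !lee_fin; lra.
Qed.
End HalfLines.

(** * Explicit expectations at a uniform variable *)

Section UniformIntegrals.
Variable R : realType.
Local Notation U01 := (uniform_prob (@ltr01 R)).
Local Notation leb := (@lebesgue_measure R).

Lemma integral_U01 (f : R -> R) : measurable_fun setT f -> (forall x, 0 <= f x) ->
  (\int[U01]_x (f x)%:E = \int[leb]_(x in `[0%R, 1%R]) (f x)%:E)%E.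
Proof.
move=> mf f0; rewrite integral_uniform //; last exact/measurable_EFinP.
by rewrite subr0 invr1 mul1e.
Qed.

Lemma U01_half_line (t : R) : fine (U01 `]-oo, t]%classic) = Num.min 1 (Num.max 0 t).
Proof.
rewrite /uniform_prob integral_uniform_pdf.
rewrite (eq_integral (fun=> 1%E)); last first.
  by move=> x; rewrite inE /= => -[_]; rewrite in_itv /= /uniform_pdf subr0 invr1 => ->.
have [t0|t0] := ltP t 0.
  rewrite (_ : _ `&` _ = set0) ?integral_set0 ?min_r //.
  by apply/seteqP; split => // x [] /=; rewrite !in_itv /=; lra.
rewrite (_ : _ `&` _ = `[0, Num.min 1 t]%classic); last first.
  apply/seteqP; split => x /=; rewrite !in_itv /= le_min.
    by move=> [-> /andP[-> ->]].
  by move=> /andP[-> /andP[-> ->]].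
rewrite integral_cst //= mul1e lebesgue_measure_itv /= lte_fin.
case: ltP => [_|m0]; first by rewrite -EFinB /= subr0.
by apply/esym/eqP; rewrite eq_le m0 /= le_min ler01.
Qed.

Lemma measurable_tail_bound m : measurable_fun setT (@tail_bound R m).
Proof. by by apply: nonincreasing_measurable => // x y xy; apply: tail_bound_nonincreasing. Qed.

(** The integrand changes branch at [2 / m], inside the unit interval as [m > 2]: the constant part
    contributes [1 / m], and [1 / (m x)] the logarithm. *)
Lemma integral_tail_bound m : (2 < m)%N ->
  (\int[U01]_x (tail_bound m x)%:E = (m%:R^-1 + ln (m%:R / 2) / m%:R)%:E)%E.
Proof.
move=> m2; have m0 : 0 < m%:R :> R by rewrite ltr0n; lia.
rewrite integral_U01; [|exact: measurable_tail_bound|by move=> x; apply: tail_bound_ge0].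
pose a : R := 2 / m%:R.
have a0 : 0 < a by rewrite divr_gt0.
have a1 : a < 1 by rewrite ltr_pdivrMr // mul1r ltr_nat.
have -> : `[0, 1]%classic = (`[0, a] `|` `]a, 1])%classic :> set R.
  apply/seteqP; split => x /=; rewrite !in_itv /=; last by case; lra.
  by case: (leP x a) => xa; [left|right]; lra.
have mt (D : set R) : measurable_fun D (fun x : R => (tail_bound m x)%:E).
  by apply/measurable_EFinP; apply: measurable_funTS; exact: measurable_tail_bound.
rewrite ge0_integral_setU //=; last 3 first.
- exact: mt.
- by move=> x _; rewrite lee_fin tail_bound_ge0.
- by apply/disj_setPS => x /=; rewrite !in_itv /=; lra.
rewrite EFinD; congr (_ + _)%E.
  rewrite (eq_integral (fun=> (2^-1)%:E)).
    rewrite integral_cst //= lebesgue_measure_itv /= lte_fin a0 -EFinB -EFinM subr0.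
    by rewrite /a mulrA mulVf ?mul1r.
  move=> x; rewrite inE /= in_itv /= => /andP[_ xa]; rewrite /tail_bound max_l //.
  by rewrite mulrC -ler_pdivlMr.
rewrite integral_itv_obnd_cbnd //.
have -> : (\int[leb]_(x in `[a, 1%R]) (tail_bound m x)%:E =
    \int[leb]_(x in `[a, 1%R]) (m%:R^-1 * x^-1)%:E)%E.
  apply: eq_integral => x; rewrite inE /= in_itv /= => /andP[ax _]; rewrite /tail_bound max_r ?invfM //.
  by rewrite mulrC -ler_pdivrMr.
have dln (x : R) : 0 < x -> is_derive x 1 (fun y => m%:R^-1 * ln y) (m%:R^-1 * x^-1).
  by move=> x0; have ? := is_derive1_ln x0; apply: is_deriveZ.
have cln (x : R) : 0 < x -> {for x, continuous (fun y : R => m%:R^-1 * ln y)}.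
  by move=> x0; apply: cvgM; [exact: cvg_cst|exact: continuous_ln].
have := @continuous_FTC2 R (fun x => m%:R^-1 * x^-1) (fun x => m%:R^-1 * ln x) a 1 a1.
move=> ->.
- rewrite -EFinB ln1 mulr0 sub0r -mulrN /a -lnV ?posrE // invf_div mulrC //.
- apply: continuous_in_subspaceT => x; rewrite inE /= in_itv /= => /andP[ax _].
  apply: cvgM; first exact: cvg_cst.
  by apply: cvgV; rewrite ?gt_eqF ?(lt_le_trans a0).
- split.
  + by move=> x; rewrite in_itv /= => /andP[ax _]; case: (dln _ (lt_trans a0 ax)).
  + by apply: cvg_at_right_filter; apply: cln.
  + by apply: cvg_at_left_filter; apply: cln.
- move=> x; rewrite in_itv /= => /andP[ax _]; rewrite derive1E.
  by case: (dln _ (lt_trans a0 ax)).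
Qed.

Lemma continuous_tail_bound m : continuous (@tail_bound R m).
Proof.
move=> x; apply: cvgV; first by rewrite gt_eqF // lt_max ltr0n.
have c2 : {for x, continuous (fun _ : R => 2 : R^o)} by apply: cvg_cst.
have cm : {for x, continuous (fun y : R => m%:R * y : R^o)}.
  by apply: cvgM; [exact: cvg_cst|exact: cvg_id].
exact: (continuous_max c2 cm).
Qed.

Lemma integral_tail_bound_onem m :
  (\int[U01]_x (tail_bound m (1 - x))%:E = \int[U01]_x (tail_bound m x)%:E)%E.
Proof.
rewrite !integral_U01; try by move=> x; apply: tail_bound_ge0.
- rewrite (@integration_by_substitution_onem R (tail_bound m) 1).
  + by rewrite /unstable.onem subrr.
  + by rewrite ler01 lexx.
  + by apply: continuous_subspaceT => x; apply: continuous_tail_bound.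
- exact: measurable_tail_bound.
- by apply: (measurableT_comp (measurable_tail_bound m)); apply: measurable_funB.
Qed.

Definition clamp01 (x : R) : R := Num.min 1 (Num.max 0 x).

Lemma clamp01_itv x : 0 <= clamp01 x <= 1.
Proof. by rewrite /clamp01 le_min ge_min lexx le_max lexx ler01. Qed.

Lemma clamp01_le x y : x <= y -> clamp01 x <= clamp01 y.
Proof.
move=> xy; rewrite /clamp01 le_min ge_min lexx /= ge_min; apply/orP; right.
by rewrite ge_max le_max lexx le_max xy orbT.
Qed.

Lemma clamp01_id x : 0 <= x <= 1 -> clamp01 x = x.
Proof. by move=> /andP[x0 x1]; rewrite /clamp01 max_r // min_r. Qed.

(* The argument is clamped so that the function is monotone on the whole line. *)
Definition binom_upper (m k : nat) (x : R) : R :=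
  pgf_expect (fun j => (k <= j)%:R) (pgf_bern (clamp01 x) ^+ m).

Lemma binom_upper_itv m k x : 0 <= binom_upper m k x <= 1.
Proof.
have x01 := clamp01_itv x.
have c1 (c : R) : pgf_expect (fun=> c) (pgf_bern (clamp01 x) ^+ m) = c.
  by rewrite pgf_expect_cst horner_exp pgf_bern1 expr1n mulr1.
rewrite -{1}(c1 0) -[X in _ && (_ <= X)](c1 1); apply/andP.
by split; apply: pgf_expect_exp_le => // j; case: (k <= j)%N.
Qed.

Lemma binom_upper_nondecreasing m k x y : x <= y -> binom_upper m k x <= binom_upper m k y.
Proof.
move=> xy; have /andP[x0 _] := clamp01_itv x; have /andP[_ y1] := clamp01_itv y.
rewrite -lerN2 -[leLHS]mulN1r -[leRHS]mulN1r /binom_upper -!pgf_expectZl.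
apply: pgf_expect_exp_nonincreasing => //; last exact: clamp01_le.
by move=> j; rewrite !mulN1r lerN2 ler_nat; case: (boolP (k <= j)%N) => // /leqW ->.
Qed.

Lemma measurable_binom_upper m k : measurable_fun setT (binom_upper m k).
Proof. by apply: nondecreasing_measurable => // x y; apply: binom_upper_nondecreasing. Qed.

Lemma integral_XMonemX (a b : nat) :
  (\int[leb]_(x in `[0%R, 1%R]) (XMonemX a b x)%:E = ((a`! * b`!)%:R / (a + b).+1`!%:R)%:E)%E.
Proof.
rewrite -beta_fun_fact EFin_beta_fun /= (integral_XMonemX_restrict setT) setTI //.
Qed.

(** By the beta integral each binomial mass has expectation [1 / (m + 1)] at a uniform parameter,
    and [m + 1 - k] indices run from [k] to [m]. *)
Lemma integral_binom_upper m k : (k <= m.+1)%N ->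
  (\int[U01]_x (binom_upper m k x)%:E = ((m.+1 - k)%:R / m.+1%:R)%:E)%E.
Proof.
move=> km; rewrite integral_U01; last 2 first.
- exact: measurable_binom_upper.
- by move=> x; have /andP[] := binom_upper_itv m k x.
pose F j (x : R) : \bar R := (('C(m, j) * (k <= j))%:R%:E * (XMonemX j (m - j) x)%:E)%E.
have -> : (\int[leb]_(x in `[0%R, 1%R]) (binom_upper m k x)%:E =
    \int[leb]_(x in `[0%R, 1%R]) (\sum_(j <- iota 0 m.+1) F j x))%E.
  apply: eq_integral => x; rewrite inE /= in_itv /= => x01.
  rewrite /binom_upper pgf_expect_binom clamp01_id // /index_iota subn0 -sumEFin.
  apply: eq_bigr => j _; rewrite /F -EFinM; congr EFin.
  rewrite binom_massE /XMonemX /unstable.onem natrM -mulr_natr; ring.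
have mX j (D : set R) : measurable_fun D (fun x : R => (XMonemX j (m - j) x)%:E).
  by apply/measurable_EFinP; exact: measurable_XMonemX.
have X0 j (x : R) : `[0, 1]%classic x -> (0 <= (XMonemX j (m - j) x)%:E)%E.
  by move=> x01; rewrite lee_fin; apply: XMonemX_ge0; exact: x01.
rewrite ge0_integral_sum //; last 2 first.
- by move=> j; apply: measurable_funeM; apply: mX.
- by move=> j x x01; apply: mule_ge0; [rewrite lee_fin|exact: X0].
have I j : (j <= m)%N -> (\int[leb]_(x in `[0%R, 1%R]) F j x = ((k <= j)%:R / m.+1%:R)%:E)%E.
  move=> jm; rewrite ge0_integralZl //; last 2 first.
  - exact: mX.
  - by move=> x; apply: X0.
  rewrite integral_XMonemX -EFinM; congr EFin; rewrite subnKC //.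
  have fm : (m`!)%:R != 0 :> R by rewrite pnatr_eq0 -lt0n fact_gt0.
  have m1 : (m.+1)%:R != 0 :> R by rewrite pnatr_eq0.
  have -> : (('C(m, j) * (k <= j))%:R * ((j`! * (m - j)`!)%:R / m.+1`!%:R) : R) =
      (k <= j)%:R * ('C(m, j) * (j`! * (m - j)`!))%:R / m.+1`!%:R.
    by rewrite !natrM; ring.
  by rewrite bin_fact // factS natrM; field; rewrite ?nat1r ?natr1 m1 fm.
rewrite big_seq (eq_bigr (fun j => ((k <= j)%:R / m.+1%:R)%:E)) -?big_seq; last first.
  by move=> j; rewrite mem_iota add0n ltnS => /andP[_ jm]; rewrite I.
rewrite sumEFin -mulr_suml -natr_sum; congr (_%:R / _)%:E.
rewrite -[iota 0 m.+1]/(index_iota 0 m.+1).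
elim: (m.+1) => [|n IH]; first by rewrite big_nil.
by rewrite big_nat_recr //= IH; case: leqP; lia.
Qed.
End UniformIntegrals.

(** * Elementary facts on means, ranks and the constant [I_const] *)

Lemma sum_sqr_mean_le (R : realFieldType) (m : nat) (f : 'I_m -> R) (p a : R) :
  \sum_i f i = m%:R * p -> \sum_i (f i - p) ^+ 2 <= \sum_i (f i - a) ^+ 2.
Proof.
move=> sf; have -> : \sum_i (f i - a) ^+ 2 =
    \sum_i (f i - p) ^+ 2 + \sum_(i < m) (p - a) ^+ 2.
  transitivity (\sum_i ((f i - p) ^+ 2 + (p - a) ^+ 2 + (f i - p) * (2 * (p - a)))).
    by apply: eq_bigr => i _; ring.
  rewrite big_split big_split /= -[X in _ + X]mulr_suml sumrB sf !sumr_const !card_ord.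
  by rewrite mulr_natl subrr mul0r addr0.
by rewrite lerDl sumr_ge0 // => i _; apply: sqr_ge0.
Qed.

(* A minimizer of [x] among the indices counted on the left separates them from the at
   least [k] indices below it. *)
Lemma card_high_rank_le (R : realDomainType) (m k : nat) (x : 'I_m -> R) :
  (#|[pred i | (k <= #|[pred l | (x l < x i)%R]|)%N]| <= m - k)%N.
Proof.
set A := [pred i | _]; have [i0 Ai0|A0] := pickP A; last by rewrite eq_card0.
case: (@arg_minP _ _ _ i0 A x Ai0) => i Ai xmin.
have AIE : #|[predI A & [pred l | x l < x i]]| = 0%N.
  apply: eq_card0 => l; apply/negP; rewrite !inE => /andP[Al].
  by rewrite ltNge xmin.
have := cardUI A [pred l | x l < x i].
rewrite AIE addn0 => cU.
have := max_card [predU A & [pred l | x l < x i]]; rewrite cU card_ord.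
by move: Ai; rewrite inE; move: #|A| #|[pred l | x l < x i]| => a b; lia.
Qed.

Lemma order_stat_ge (R : realType) (m : nat) (x : 'I_m -> R) (k : nat) (z : R) : (0 < k)%N ->
  (z%:E <= order_stat x k)%E = ~~ (k <= #|[pred i | (x i < z)%R]|)%N.
Proof.
move=> k0; rewrite /order_stat; set s := sort _ _.
have ss : size s = m by rewrite size_sort size_map size_enum_ord.
have cs : count (< z) s = #|[pred i | x i < z]|.
  rewrite count_sort count_map -sum1_count big_enum_cond -sum1_card.
  by apply: eq_bigl => i; rewrite !inE.
have so : sorted <=%R s by apply: sort_sorted; exact: le_total.
have -> : (k <= #|[pred i | (x i < z)%R]|)%N = (k.-1 < #|[pred i | (x i < z)%R]|)%N.
  by rewrite prednK.
(* For [k > m] the default value [+oo] is read, and at most [m] scores are below [z]. *)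
have [km|mk] := ltnP k.-1 m; last first.
  rewrite nth_default ?size_map ?ss // leey; symmetry; rewrite -leqNgt.
  by apply: leq_trans mk; rewrite -[leqRHS]card_ord max_card.
rewrite (nth_map 0) ?ss // lee_fin -cs; apply/idP/idP.
  by apply: contraTN => /(nth_count_lt 0 so); rewrite ltNge.
by rewrite -leqNgt => ck; apply: nth_count_ge; rewrite ?ck ?ss.
Qed.

(** The left side is the expectation of [tail_bound m x + tail_bound m (1 - x)] at a uniform [x]. As
    [(1 - s) (1 + s) = 4 / m], both sides have a factor [2 / m] and [m / 2] is [(1 + s) / (1 - s)]
    times [2 / (1 + s)^2]; the logarithm of the latter is bounded by [ln u <= u - 1]. *)
Lemma I_const_ge (R : realType) (m : nat) : (4 < m)%N ->
  2 * (m%:R^-1 + ln (m%:R / 2) / m%:R) <= I_const R m.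
Proof.
move=> m4; rewrite /I_const leqNgt m4 /=; set s := Num.sqrt _.
have m0 : 0 < m%:R :> R by rewrite ltr0n; lia.
have r0 : 0 < 1 - 4 / m%:R :> R by rewrite subr_gt0 ltr_pdivrMr // mul1r ltr_nat.
have s0 : 0 < s by rewrite sqrtr_gt0.
have s2 : s ^+ 2 = 1 - 4 / m%:R by rewrite sqr_sqrtr // ltW.
have s1 : s < 1.
  by rewrite -(@ltr_pXn2r _ 2) ?nnegrE ?ltW // expr1n s2 ltrBlDr ltrDl divr_gt0.
have sp : 0 < 1 + s by rewrite addr_gt0.
have sm : 0 < 1 - s by rewrite subr_gt0.
have su : 1 - s != 0 by rewrite gt_eqF.
have pu : 1 + s != 0 by rewrite gt_eqF.
have mE : m%:R = 4 / ((1 - s) * (1 + s)) :> R.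
  have -> : (1 - s) * (1 + s) = 4 / m%:R by rewrite (_ : _ * _ = 1 - s ^+ 2); [rewrite s2; ring | ring].
  by rewrite invf_div mulrCA divff ?mulr1 ?pnatr_eq0.
have lnE : ln (m%:R / 2) = ln ((1 + s) / (1 - s)) + ln (2 / (1 + s) ^+ 2).
  rewrite -lnM ?posrE ?divr_gt0 ?exprn_gt0 //; congr ln; rewrite mE; field.
  by rewrite su pu.
have ln_le : ln (2 / (1 + s) ^+ 2) <= 2 / (1 + s) ^+ 2 - 1.
  rewrite -{1}[2 / _](subrKC 1); apply: le_ln1Dx.
  by rewrite ltrBrDr addNr divr_gt0 ?exprn_gt0.
have h : 1 + ln (m%:R / 2) <= 2 / (1 + s) + ln ((1 + s) / (1 - s)).
  rewrite lnE addrCA addrC lerD2r; apply: le_trans (_ : 2 / (1 + s) ^+ 2 <= _); first by lra.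
  rewrite ler_pM2l // lef_pV2 ?posrE ?exprn_gt0 // expr2 ler_peMl ?ltW //.
  by rewrite ltrDl.
have e1 : 2 * (m%:R^-1 + ln (m%:R / 2) / m%:R) = 2 / m%:R * (1 + ln (m%:R / 2)) :> R by ring.
have e2 : 1 - s = 2 / m%:R * (2 / (1 + s)) by rewrite mE; field; rewrite su pu.
by rewrite e1 {1}e2 -mulrDr ler_pM2l ?divr_gt0.
Qed.

Lemma ks_dist_ge (R : realType) (F G : R -> R) (t : R) :
  (forall x, 0 <= F x <= 1) -> (forall x, 0 <= G x <= 1) -> `|F t - G t| <= ks_dist F G.
Proof.
move=> F01 G01; apply: ub_le_sup; last by exists t.
by exists 1 => _ [x _ <-]; have := F01 x; have := G01 x; rewrite ler_norml; lra.
Qed.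

(** * Expectations of monotone functions under close laws *)

Section MonotoneExpectation.
Context d (T : measurableType d) (R : realType) (P : probability T R).
Variables (W : {RV P >-> R}) (nu : probability (measurableTypeR R) R) (k : R).
Hypothesis W_close : forall t,
  `|fine (distribution P W `]-oo, t]%classic) - fine (nu `]-oo, t]%classic)| <= k.

(** The superlevel sets of a monotone function are upper or lower sets, so the tails of [f] under
    the two laws differ by at most [k], and the layer-cake comparison applies. *)
Lemma expectation_monotone_close (f : R -> R) c : 0 <= c -> (forall x, 0 <= f x <= c) ->
  {homo f : x y / x <= y} \/ {homo f : x y /~ x <= y} ->
  (\int[P]_w (f (W w))%:E <= \int[nu]_x (f x)%:E + (c * k)%:E)%E /\
  (\int[nu]_x (f x)%:E <= \int[P]_w (f (W w))%:E + (c * k)%:E)%E.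
Proof.
move=> c0 f0c mono.
have k0 : 0 <= k by apply: le_trans (W_close 0); apply: normr_ge0.
have mW : measurable_fun setT (W : T -> measurableTypeR R).
  by move=> _ A mA; apply: measurable_funPT.
pose W' : {mfun T >-> measurableTypeR R} := @mfun_Sub _ _ T (measurableTypeR R) W (mem_set mW).
pose mu : probability (measurableTypeR R) R := distribution P W'.
have fin t : (mu `]-oo, t]%classic \is a fin_num) /\ (nu `]-oo, t]%classic \is a fin_num).
  by split; apply: fin_num_measure.
have le1 t : (mu `]-oo, t]%classic <= nu `]-oo, t]%classic + k%:E)%E.
  have [f1 f2] := fin t; have := W_close t.
  rewrite -(fineK f1) -(fineK f2) -EFinD lee_fin /= ler_norml; lra.
have le2 t : (nu `]-oo, t]%classic <= mu `]-oo, t]%classic + k%:E)%E.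
  have [f1 f2] := fin t; have := W_close t.
  rewrite -(fineK f1) -(fineK f2) -EFinD lee_fin /= ler_norml; lra.
have mf : measurable_fun setT f.
  by case: mono => h; [apply: nondecreasing_measurable|apply: nonincreasing_measurable] => // x y xy; apply: h.
have mfW : measurable_fun setT (f \o W) by apply: measurableT_comp.
have tails r : (mu [set x | (r < f x)%R] <= nu [set x | (r < f x)%R] + k%:E)%E /\
    (nu [set x | (r < f x)%R] <= mu [set x | (r < f x)%R] + k%:E)%E.
  case: mono => h.
    have up x y : x <= y -> [set x | r < f x] x -> [set x | r < f x] y.
      by move=> xy /= /lt_le_trans; apply; apply: h.
    by split; [exact: (prob_upper_set_le k0 le2)|exact: (prob_upper_set_le k0 le1)].
  have down x y : x <= y -> [set x | r < f x] y -> [set x | r < f x] x.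
    by move=> xy /= /lt_le_trans; apply; apply: h.
  by split; [exact: (prob_lower_set_le k0 le1)|exact: (prob_lower_set_le k0 le2)].
by split; apply: ge0_integral_le_tail => // r; have [] := tails r.
Qed.
End MonotoneExpectation.

(** * Distribution functions of the scores and their average *)

Section Conformal.
Context d (T : measurableType d) (R : realType) (P : probability T R) (m : nat).
Variable Z : 'I_m.+1 -> {RV P >-> R}.
Hypothesis m_gt0 : (0 < m)%N.
Local Notation V := (Z ord_max).
Local Notation Fbar := (avg_df Z).

Lemma score_df_itv i z : 0 <= score_df Z i z <= 1.
Proof.
rewrite /score_df fine_ge0 //= -lee_fin fineK ?fin_num_measure //; last exact: measurable_below.
by apply: probability_le1; apply: measurable_below.
Qed.

Lemma score_df_nondecreasing i : {homo score_df Z i : x y / x <= y}.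
Proof.
move=> x y xy; apply: fine_le; rewrite ?fin_num_measure //; try exact: measurable_below.
apply: le_measure; rewrite ?inE; try exact: measurable_below.
by move=> w /= /lt_le_trans; apply.
Qed.

Lemma sum_score_df z : \sum_(i < m) score_df Z (calib i) z = m%:R * Fbar z.
Proof. by rewrite /avg_df mulrA divff ?mul1r // pnatr_eq0 -lt0n. Qed.

Lemma avg_df_itv z : 0 <= Fbar z <= 1.
Proof.
rewrite /avg_df mulr_ge0 ?invr_ge0 ?sumr_ge0 //=; last by move=> i _; have /andP[] := score_df_itv (calib i) z.
rewrite mulrC ler_pdivrMr ?ltr0n // mul1r.
have -> : m%:R = \sum_(i < m) (1 : R) by rewrite sumr_const card_ord.
by apply: ler_sum => i _; have /andP[] := score_df_itv (calib i) z.
Qed.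

Lemma avg_df_nondecreasing : {homo Fbar : x y / x <= y}.
Proof.
move=> x y xy; rewrite /avg_df ler_wpM2l ?invr_ge0 //.
by apply: ler_sum => i _; apply: score_df_nondecreasing.
Qed.

Lemma sum_sqr_score_df_le z :
  \sum_(i < m) (score_df Z (calib i) z - Fbar z) ^+ 2 <= \sum_(i < m) kappa Z i ^+ 2.
Proof.
(* Replacing the mean by the distribution function of the last score increases the sum of squares,
   and each difference is then at most [kappa Z i]. *)
apply: le_trans (sum_sqr_mean_le (score_df Z ord_max z) (sum_score_df z)) _.
apply: ler_sum => i _; rewrite -real_normK ?num_real //.
have := ks_dist_ge z (score_df_itv (calib i)) (score_df_itv ord_max).
by rewrite -/(kappa Z i) => h; rewrite lerXn2r ?nnegrE // (le_trans _ h).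
Qed.

Let measurable_W : measurable_fun setT (Fbar \o V).
Proof.
apply: measurableT_comp => //; apply: nondecreasing_measurable => //.
exact: avg_df_nondecreasing.
Qed.

Definition avg_df_score : {RV P >-> R} := mfun_Sub (mem_set measurable_W).

Lemma prob_fine_itv d0 (T0 : measurableType d0) (Q : probability T0 R) A : measurable A ->
  0 <= fine (Q A) <= 1.
Proof.
move=> mA; rewrite fine_ge0 //= -lee_fin fineK ?fin_num_measure //.
exact: probability_le1.
Qed.

Lemma ks_unif_ge t :
  `|fine (distribution P avg_df_score `]-oo, t]%classic) -
    fine (uniform_prob (@ltr01 R) `]-oo, t]%classic)| <= ks_unif Z.
Proof.
apply: (ks_dist_ge t (F := fun t => fine (distribution P avg_df_score `]-oo, t]%classic))
  (G := fun t => fine (uniform_prob (@ltr01 R) `]-oo, t]%classic))) => x;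
  exact: prob_fine_itv.
Qed.

Lemma ks_unif_ge0 : 0 <= ks_unif Z.
Proof. by apply: le_trans (ks_unif_ge 0); apply: normr_ge0. Qed.

Definition is_calib : pred 'I_m.+1 := fun i => i != ord_max.

Lemma big_calib (S : Type) (idx : S) (op : Monoid.com_law idx) (F : 'I_m.+1 -> S) :
  \big[op/idx]_(i | is_calib i) F i = \big[op/idx]_(i < m) F (calib i).
Proof.
rewrite big_mkcond big_ord_recr /= /is_calib eqxx /= Monoid.mulm1.
by apply: eq_bigr => i _; rewrite ifT // -val_eqE /= ltn_eqF.
Qed.

Lemma card_calib (A : pred 'I_m.+1) :
  #|[pred i | is_calib i && A i]| = #|[pred i : 'I_m | A (calib i)]|.
Proof.
rewrite -!sum1_card big_mkcondr /= (big_calib _ (fun i => if A i then 1%N else 0%N)).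
by rewrite [RHS]big_mkcond.
Qed.

End Conformal.

(** * Miscoverage *)

Section Miscoverage.
Context d (T : measurableType d) (R : realType) (P : probability T R) (m : nat).
Variable Z : 'I_m.+1 -> {RV P >-> R}.
Hypothesis m_gt0 : (0 < m)%N.
Hypothesis Z_indep : mutually_independent Z.
Local Notation V := (Z ord_max).
Local Notation Fbar := (avg_df Z).
Local Notation W := (avg_df_score Z).
Local Notation U01 := (uniform_prob (@ltr01 R)).
Local Notation calib_pred := (@is_calib m).

Definition miss_event (k : nat) : set T :=
  [set w | (k <= count_below Z calib_pred w (V w))%N].

(** The conditional probability of a miss when the last score equals [z]. *)
Definition miss_prob_at (k : nat) (z : R) : R :=
  pgf_expect (fun j => (k <= j)%:R)
    (pgf_indep xpredT (fun i : 'I_m => score_df Z (calib i) z)).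

Let not_calib_max : ~~ calib_pred ord_max.
Proof. by rewrite /is_calib eqxx. Qed.

Lemma miss_prob_atE k z :
  (miss_prob_at k z)%:E = P [set w | k <= count_below Z calib_pred w z]%N.
Proof.
rewrite (prob_count_below Z_indep) /miss_prob_at; congr (pgf_expect _ _)%:E.
by rewrite /pgf_indep (big_calib _ (fun i => pgf_bern (score_df Z i z))).
Qed.

Lemma measurable_miss_event k : measurable (miss_event k).
Proof. exact: measurable_count_at_score. Qed.

Lemma miss_eventE k : P (miss_event k) = (\int[P]_w (miss_prob_at k (V w))%:E)%E.
Proof.
have [_ ->] := decoupling_count Z_indep k not_calib_max.
by apply: eq_integral => w _; rewrite miss_prob_atE.
Qed.

Lemma miss_prob_at_ge0 k z : 0 <= miss_prob_at k z.
Proof. by rewrite -lee_fin miss_prob_atE. Qed.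

Lemma measurable_miss_prob_at k : measurable_fun setT (fun w => miss_prob_at k (V w)).
Proof.
apply: (measurableT_comp (f := miss_prob_at k)) => //.
apply: nondecreasing_measurable => // x y xy; rewrite -lee_fin !miss_prob_atE.
have mc z : measurable [set w | k <= count_below Z calib_pred w z]%N.
  exact: (measurable_count_below Z _ _ not_calib_max).
apply: le_measure; rewrite ?inE; [exact: mc|exact: mc|move=> w /= /leq_trans; apply].
apply: subset_leq_card; apply/fintype.subsetP => i; rewrite !inE => /andP[-> zx] /=.
exact: lt_le_trans xy.
Qed.

Local Notation K := (\sum_(i < m) kappa Z i ^+ 2).

Lemma sum_sqr_kappa_ge0 : 0 <= K.
Proof. by apply: sumr_ge0 => i _; apply: sqr_ge0. Qed.

Lemma miss_prob_at_binom k z :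
  `|miss_prob_at k z - binom_upper m k (Fbar z)| <=
  K * (tail_bound m (Fbar z) + tail_bound m (1 - Fbar z)).
Proof.
(* The second difference of the indicator of [k <= j] is nonzero only at [j = k - 1] and
   [j = k - 2], where it is [-1] and [1]. *)
have h2 j : `|(k <= j.+2)%:R - 2 * (k <= j.+1)%:R + (k <= j)%:R| <= 1 :> R.
  have [kj|kj] := leqP k j.
    by rewrite !(leqW kj) !(leqW (leqW kj)) ler_norml /=; lra.
  have [kj1|kj1] := leqP k j.+1; first by rewrite (leqW kj1) ler_norml /=; lra.
  by case: (k <= j.+2)%N; rewrite ler_norml /=; lra.
have h01 j : 0 <= ((k <= j)%:R : R) <= 1 by case: (k <= j)%N; rewrite ?lexx ?ler01.
have := pgf_indep_binomial m_gt0 (card_ord m) h01 h2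
  (fun i => score_df_itv Z (calib i) z) (sum_score_df Z m_gt0 z).
rewrite /binom_upper clamp01_id; last exact: avg_df_itv.
move=> /le_trans; apply; rewrite mulrC; apply: ler_wpM2r.
  by rewrite addr_ge0 ?tail_bound_ge0.
exact: sum_sqr_score_df_le.
Qed.

Lemma measurable_tail_W : measurable_fun setT (fun w => tail_bound m (W w) : R).
Proof. by apply: (measurableT_comp (@measurable_tail_bound R m)). Qed.

Lemma measurable_tail_onem_W : measurable_fun setT (fun w => tail_bound m (1 - W w)).
Proof.
by apply: (measurableT_comp (@measurable_tail_bound R m)); apply: measurable_funB.
Qed.

Local Notation tails := (\int[P]_w (tail_bound m (W w))%:E +
  \int[P]_w (tail_bound m (1 - W w))%:E)%E.

(** For [m <= 4] each expectation is at most [1/2] and [I_const R m = 1]. For larger [m] both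
    functions are monotone with values in [[0, 1/2]], so replacing [W] by a uniform variable costs
    half of [ks_unif Z] each time. *)
Lemma tail_expectation_le : (tails <= (I_const R m + ks_unif Z)%:E)%E.
Proof.
have k0 : 0 <= ks_unif Z := ks_unif_ge0 Z.
have half0 : 0 <= 2^-1 :> R by rewrite invr_ge0.
have tb01 (x : R) : 0 <= tail_bound m x <= 2^-1 by rewrite tail_bound_ge0 tail_bound_le_half.
have [m4|m4] := leqP m 4.
  rewrite /I_const m4.
  have half (f : T -> R) : measurable_fun setT f -> (forall w, 0 <= f w <= 2^-1) ->
      (\int[P]_w (f w)%:E <= (2^-1 : R)%:E)%E.
    move=> mf f0h; apply: le_trans (_ : \int[P]_w (2^-1 : R)%:E <= _)%E.
      apply: ge0_le_integral => //.
      - by move=> w _; rewrite lee_fin; have /andP[] := f0h w.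
      - exact/measurable_EFinP.
      - by move=> w _; rewrite lee_fin; have /andP[] := f0h w.
    by rewrite integral_cst //= probability_setT mule1.
  apply: le_trans (leeD (half _ measurable_tail_W _) (half _ measurable_tail_onem_W _)) _ => //.
  by rewrite -EFinD lee_fin; lra.
have [t1 _] := expectation_monotone_close (ks_unif_ge Z) half0 tb01
  (or_intror (fun x y => @tail_bound_nonincreasing R m y x)).
have tb01' (x : R) : 0 <= tail_bound m (1 - x) <= 2^-1 by apply: tb01.
have mono2 : {homo (fun x : R => tail_bound m (1 - x)) : x y / x <= y}.
  by move=> x y xy; apply: tail_bound_nonincreasing; rewrite lerD2l lerN2.
have [t2 _] := expectation_monotone_close (ks_unif_ge Z) half0 tb01' (or_introl mono2).
have m2 : (2 < m)%N by lia.
move: t1 t2; rewrite integral_tail_bound_onem integral_tail_bound // => t1 t2.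
apply: le_trans (leeD t1 t2) _; rewrite -!EFinD lee_fin.
by have := I_const_ge R m4; lra.
Qed.

Lemma expectation_le_tails (u v : T -> R) :
  measurable_fun setT u -> measurable_fun setT v ->
  (forall w, 0 <= u w) -> (forall w, 0 <= v w) ->
  (forall w, u w <= v w + K * (tail_bound m (W w) + tail_bound m (1 - W w))) ->
  (\int[P]_w (u w)%:E <= \int[P]_w (v w)%:E + K%:E * (I_const R m + ks_unif Z)%:E)%E.
Proof.
move=> mu mv u0 v0 uv; have K0 := sum_sqr_kappa_ge0.
have mt : measurable_fun setT (fun w => tail_bound m (W w) + tail_bound m (1 - W w)).
  by apply: measurable_funD; [exact: measurable_tail_W|exact: measurable_tail_onem_W].
have t0 w : 0 <= tail_bound m (W w) + tail_bound m (1 - W w) by rewrite addr_ge0 ?tail_bound_ge0.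
apply: le_trans (_ : \int[P]_w (v w)%:E + K%:E * tails <= _)%E; last first.
  by rewrite leeD2l // lee_wpmul2l ?lee_fin // tail_expectation_le.
rewrite -ge0_integralD //; last 4 first.
- by move=> w _; rewrite lee_fin tail_bound_ge0.
- by apply/measurable_EFinP; exact: measurable_tail_W.
- by move=> w _; rewrite lee_fin tail_bound_ge0.
- by apply/measurable_EFinP; exact: measurable_tail_onem_W.
rewrite -ge0_integralZl ?lee_fin //; last 2 first.
- by apply/measurable_EFinP.
- by move=> w _; rewrite -EFinD lee_fin.
rewrite -ge0_integralD //; last 4 first.
- by move=> w _; rewrite lee_fin.
- exact/measurable_EFinP.
- by move=> w _; rewrite -EFinD -EFinM lee_fin mulr_ge0.
- by apply: measurable_funeM; apply/measurable_EFinP.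
apply: ge0_le_integral => //.
- by move=> w _; rewrite lee_fin.
- exact/measurable_EFinP.
- apply: emeasurable_funD; first exact/measurable_EFinP.
  by apply: measurable_funeM; apply/measurable_EFinP.
- by move=> w _; rewrite -EFinD lee_fin uv.
Qed.

(** Two replacements: the conditional miss probability by a binomial tail at [W], at the cost of the
    tail terms, then [W] by a uniform variable, at the cost of [ks_unif Z]. *)
Lemma miss_event_close k : (k <= m.+1)%N ->
  `|fine (P (miss_event k)) - (m.+1 - k)%:R / m.+1%:R| <= conformal_delta Z.
Proof.
move=> km.
have b0 w : 0 <= binom_upper m k (W w) by have /andP[] := binom_upper_itv m k (W w).
have mb : measurable_fun setT (fun w => binom_upper m k (W w)).
  by apply: (measurableT_comp (@measurable_binom_upper R m k)).
have mh := measurable_miss_prob_at k.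
have h0 w : 0 <= miss_prob_at k (V w) by apply: miss_prob_at_ge0.
have close w := miss_prob_at_binom k (V w).
have up : (\int[P]_w (miss_prob_at k (V w))%:E <= \int[P]_w (binom_upper m k (W w))%:E +
    K%:E * (I_const R m + ks_unif Z)%:E)%E.
  apply: expectation_le_tails => // w; rewrite -lerBlDl.
  by apply: le_trans (close w); apply: ler_norm.
have lo : (\int[P]_w (binom_upper m k (W w))%:E <= \int[P]_w (miss_prob_at k (V w))%:E +
    K%:E * (I_const R m + ks_unif Z)%:E)%E.
  apply: expectation_le_tails => // w; rewrite -lerBlDl.
  by apply: le_trans (close w); rewrite distrC; apply: ler_norm.
have [bup blo] := expectation_monotone_close (ks_unif_ge Z) ler01 (binom_upper_itv m k)
  (or_introl (fun x y => @binom_upper_nondecreasing R m k x y)).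
have Mfin : P (miss_event k) \is a fin_num.
  by rewrite fin_num_measure //; apply: measurable_miss_event.
rewrite -miss_eventE -(fineK Mfin) in up lo.
move: up lo bup blo; rewrite integral_binom_upper // mul1r.
have bfin : (\int[P]_w (binom_upper m k (W w))%:E)%E \is a fin_num.
  rewrite ge0_fin_numE; last by apply: integral_ge0 => w _; rewrite lee_fin.
  rewrite (le_lt_trans _ (ltry ((m.+1 - k)%:R / m.+1%:R + ks_unif Z))) //.
  by have [+ _] := expectation_monotone_close (ks_unif_ge Z) ler01 (binom_upper_itv m k)
    (or_introl (fun x y => @binom_upper_nondecreasing R m k x y));
    rewrite integral_binom_upper // mul1r EFinD.
rewrite -(fineK bfin) -!EFinM -!EFinD !lee_fin /conformal_delta ler_norml.
move: (K * _) (_ / _) => X q; move: (ks_unif Z) (fine _) => u b; move: (fine _) => c. lra.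
Qed.

End Miscoverage.

(** * The last score against the average law of the calibration scores *)

Section LeaveOneOut.
Context d (T : measurableType d) (R : realType) (P : probability T R) (m : nat).
Variable Z : 'I_m.+1 -> {RV P >-> R}.
Hypothesis m_gt0 : (0 < m)%N.
Hypothesis Z_indep : mutually_independent Z.
Hypothesis Z_cont : forall i, continuous_rv (Z i).
Local Notation V := (Z ord_max).
Local Notation Fbar := (avg_df Z).
Local Notation W := (avg_df_score Z).
Local Notation calib_pred := (@is_calib m).

Let ks_ge0 : 0 <= ks_unif Z := ks_unif_ge0 Z.

Let mpre i (D : set R) : measurable D -> measurable (Z i @^-1` D).
Proof. by move=> mD; rewrite -[X in measurable X]setTI; apply: measurable_funPT. Qed.

Lemma fine_prob_le (A B : set T) : measurable A -> measurable B -> A `<=` B ->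
  fine (P A) <= fine (P B).
Proof.
move=> mA mB AB; apply: fine_le; rewrite ?fin_num_measure //.
by apply: le_measure; rewrite ?inE.
Qed.

(** As [Fbar] is monotone, [W <= Fbar a - e] forces [V < a], and the former has probability at least
    [Fbar a - e - ks_unif Z]; then [e] tends to [0]. *)
Lemma avg_df_le_last a : Fbar a <= fine (P [set w | V w < a]) + ks_unif Z.
Proof.
apply/ler_addgt0Pr => e e0; have /andP[F0 F1] := avg_df_itv Z m_gt0 a.
have mW t : measurable [set w | W w <= t].
  have -> : [set w | W w <= t] = W @^-1` `]-oo, t]%classic.
    by apply/seteqP; split => w /=; rewrite in_itv.
  by rewrite -[X in measurable X]setTI; apply: measurable_funPT.
have sub : [set w | W w <= Fbar a - e] `<=` [set w | V w < a].
  move=> w /= Wa; rewrite ltNge; apply/negP => aV.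
  by have := avg_df_nondecreasing Z aV; move: Wa; rewrite /=; lra.
have := fine_prob_le (mW _) (measurable_below Z ord_max a) sub.
have := ks_unif_ge Z (Fbar a - e); rewrite U01_half_line.
have -> : distribution P W `]-oo, Fbar a - e]%classic = P [set w | W w <= Fbar a - e].
  by rewrite /distribution /pushforward; congr (P _); apply/seteqP; split => w /=; rewrite in_itv.
have : Fbar a - e <= Num.min 1 (Num.max 0 (Fbar a - e)).
  by rewrite le_min le_max lexx orbT andbT; lra.
rewrite ler_norml; move: (Num.min _ _) (fine _) => x y; move: (fine _) => z; lra.
Qed.

(** For [s > a] the average on the left is at most [Fbar s], to which the open half-line estimate
    applies; continuity of the distribution function of [V] lets [s] decrease to [a]. *)
Lemma avg_half_line_le_last a :
  m%:R^-1 * \sum_(i < m) fine (P [set w | Z (calib i) w <= a]) <=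
  fine (P [set w | V w <= a]) + ks_unif Z.
Proof.
have cdfE i t : [set w | Z i w <= t] = Z i @^-1` `]-oo, t]%classic.
  by apply/seteqP; split => w /=; rewrite in_itv.
have mle i t : measurable [set w | Z i w <= t] by rewrite cdfE; apply: mpre.
set G := _ * _.
have right s : a < s -> G <= fine (cdf V s) + ks_unif Z.
  move=> sa; have VE : cdf V s = P [set w | V w <= s] by rewrite cdfE.
  apply: (@le_trans _ _ (Fbar s)).
    rewrite /G /avg_df ler_wpM2l ?invr_ge0 //; apply: ler_sum => i _.
    apply: fine_prob_le => //; first exact: measurable_below.
    by move=> w /= /le_lt_trans; apply.
  apply: le_trans (avg_df_le_last s) _; rewrite lerD2r VE.
  apply: fine_prob_le => //; first exact: measurable_below.
  by move=> w /= /ltW.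
have -> : P [set w | V w <= a] = cdf V a by rewrite cdfE.
rewrite -lerBlDr leNgt; apply/negP => lt.
have cV : (fun t => fine (cdf V t)) @ a^'+ --> fine (cdf V a).
  by apply: cvg_at_right_filter; apply: Z_cont.
have near1 : \forall s \near a^'+, fine (cdf V s) < G - ks_unif Z.
  by apply: (cvgr_lt _ cV).
have near2 : \forall s \near a^'+, a < s by exact: nbhs_right_gt.
have [s [s1 s2]] : exists s, fine (cdf V s) < G - ks_unif Z /\ a < s.
  by apply: (@filter_ex _ (a^'+)); apply: filterI near1 near2.
by have := right s s2; move: s1; lra.
Qed.

Lemma upper_set_le_last (D : set R) : (forall x y, x <= y -> D x -> D y) ->
  fine (P (V @^-1` D)) <= m%:R^-1 * \sum_(i < m) fine (P (Z (calib i) @^-1` D)) + ks_unif Z.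
Proof.
move=> Dup; have Ldown x y : x <= y -> (~` D) y -> (~` D) x.
  by move=> xy; apply: contra_not; apply: Dup.
have mD : measurable D by rewrite -[D]setCK; apply: measurableC; exact: measurable_lower_set.
have mu : m%:R^-1 * m%:R = 1 :> R by rewrite mulVf // pnatr_eq0 -lt0n.
have low : m%:R^-1 * \sum_(i < m) fine (P (Z (calib i) @^-1` (~` D))) <=
    fine (P (V @^-1` (~` D))) + ks_unif Z.
  have [->|->|[a ->]|[a ->]] := lower_set_half_line Ldown.
  - rewrite big1 ?mulr0 ?addr_ge0 ?fine_ge0 // => i _.
    by rewrite preimage_set0 measure0.
  - have T1 i : fine (P (Z i @^-1` setT)) = 1 by rewrite preimage_setT probability_setT.
    rewrite T1 (eq_bigr (fun=> 1)) => [|i _]; last by rewrite ?T1.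
    by rewrite sumr_const card_ord mu lerDl.
  - have E i : Z i @^-1` `]-oo, a]%classic = [set w | Z i w <= a].
      by apply/seteqP; split => w /=; rewrite in_itv.
    under eq_bigr do rewrite E.
    by rewrite E avg_half_line_le_last.
  - have E i : Z i @^-1` `]-oo, a[%classic = [set w | Z i w < a].
      by apply/seteqP; split => w /=; rewrite in_itv.
    under eq_bigr do rewrite E.
    by rewrite E avg_df_le_last.
have compl i : fine (P (Z i @^-1` (~` D))) = 1 - fine (P (Z i @^-1` D)).
  by rewrite preimage_setC probability_setC ?fineB ?fin_num_measure //; apply: mpre.
move: low; rewrite compl; under eq_bigr do rewrite compl.
rewrite sumrB sumr_const card_ord mulrBr mu.
by move: (m%:R^-1 * _) => x; lra.
Qed.
End LeaveOneOut.

(** The sum of the probabilities is the expected number of events that occur. *)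
Lemma sum_prob_le_overlap d (T : measurableType d) (R : realType) (P : probability T R)
    (m n : nat) (A : 'I_m -> set T) (inA : 'I_m -> T -> bool) :
  (forall i, measurable (A i)) -> (forall i w, A i w <-> inA i w) ->
  (forall w, #|[pred i | inA i w]| <= n)%N ->
  (\sum_(i < m) P (A i) <= (n%:R : R)%:E)%E.
Proof.
move=> mA AE overlap.
have PE i : P (A i) = (\int[P]_w (\1_(A i) w)%:E)%E by rewrite integral_indic // setIT.
rewrite (eq_bigr (fun i => \int[P]_w (\1_(A i) w)%:E)%E) => [|i _]; last exact: PE.
rewrite -ge0_integral_sum //; last first.
  by move=> i; apply/measurable_EFinP; apply: measurable_indic.
apply: le_trans (_ : \int[P]_w (n%:R : R)%:E <= _)%E; last first.
  by rewrite integral_cst //= probability_setT mule1.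
apply: ge0_le_integral => //.
- by move=> w _; apply: sume_ge0.
- by apply: emeasurable_sum => i; apply/measurable_EFinP; apply: measurable_indic.
- move=> w _; rewrite sumEFin lee_fin; apply: le_trans (_ : #|[pred i | inA i w]|%:R <= _); last first.
    by rewrite ler_nat.
  rewrite -sum1_card natr_sum [in leRHS]big_mkcond /=; apply: ler_sum => i _.
  rewrite inE indicE; case: ifP => iA; first by case: (w \in A i).
  by rewrite memNset //= => /AE; rewrite iA.
Qed.

(** * One-sided bound on the miss probability *)

Section MissBound.
Context d (T : measurableType d) (R : realType) (P : probability T R) (m : nat).
Variable Z : 'I_m.+1 -> {RV P >-> R}.
Hypothesis m_gt0 : (0 < m)%N.
Hypothesis Z_indep : mutually_independent Z.
Hypothesis Z_cont : forall i, continuous_rv (Z i).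
Local Notation V := (Z ord_max).
Local Notation calib_pred := (@is_calib m).

(* Given the calibration scores, the last score falls in the upper set [D w] of values
   above rank [k] with probability at most the average, over fresh copies of the
   calibration scores, plus the distance to uniformity. Dropping the [i]-th score from
   the count makes the fresh copy of [Z i] interchangeable with [Z i] itself, and at most
   [m - k.-1] calibration scores can have rank above [k.-1]. *)
Lemma miss_event_le k : (0 < k)%N ->
  fine (P (miss_event Z k)) <= (m - k.-1)%:R / m%:R + ks_unif Z.
Proof.
move=> k0; have not_max : ~~ calib_pred ord_max by rewrite /is_calib eqxx.
have ks0 := ks_unif_ge0 Z.
pose J (i : 'I_m) : pred 'I_m.+1 := fun l => calib_pred l && (l != calib i).
have nJ i : ~~ J i (calib i) by rewrite /J eqxx andbF.
have ci i : calib_pred (calib i) by rewrite /is_calib -val_eqE /= ltn_eqF.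
(* The outcome [w] fixes the calibration scores other than the [i]-th, and [w'] draws a fresh copy
   of the [i]-th. *)
pose g (i : 'I_m) w := P [set w' | k.-1 <= count_below Z (J i) w (Z (calib i) w')]%N.
have mg i : measurable_fun setT (g i) by apply: measurable_decoupled.
pose A i := [set w | k.-1 <= count_below Z (J i) w (Z (calib i) w)]%N.
have gA i : (\int[P]_w g i w = P (A i))%E.
  by have [<- _] := decoupling_count Z_indep k.-1 (nJ i).
have m0 : 0 <= m%:R^-1 :> R by rewrite invr_ge0.
have pointwise w : (P [set w' | (k <= count_below Z calib_pred w (V w'))%N] <=
    m%:R^-1%:E * (\sum_(i < m) g i w) + (ks_unif Z)%:E)%E.
  pose D := [set z | (k <= count_below Z calib_pred w z)%N].
  have Dup x y : x <= y -> D x -> D y.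
    move=> xy /= /leq_trans; apply; apply: subset_leq_card.
    by apply/fintype.subsetP => i; rewrite !inE => /andP[-> zx] /=; apply: lt_le_trans xy.
  have mD : measurable D.
    rewrite -[D]setCK; apply: measurableC; apply: measurable_lower_set => x y xy.
    by apply: contra_not; apply: Dup.
  have mpre i (B : set R) : measurable B -> measurable (Z i @^-1` B).
    by move=> mB; rewrite -[X in measurable X]setTI; apply: measurable_funPT.
  have mZD i : measurable (Z i @^-1` D) by apply: mpre.
  have mZJ i : measurable [set w' | k.-1 <= count_below Z (J i) w (Z (calib i) w')]%N.
    have mDJ : measurable [set z | (k.-1 <= count_below Z (J i) w z)%N].
      rewrite -[X in measurable X]setCK; apply: measurableC.
      apply: measurable_lower_set => x y xy; apply: contra_not => /= /leq_trans; apply.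
      apply: subset_leq_card; apply/fintype.subsetP => l; rewrite !inE => /andP[-> zx] /=.
      exact: lt_le_trans xy.
    exact: mpre mDJ.
  have gfin i : g i w \is a fin_num by rewrite fin_num_measure.
  have -> : (\sum_(i < m) g i w = (\sum_(i < m) fine (g i w))%:E)%E.
    by rewrite -sumEFin; apply: eq_bigr => i _; rewrite fineK.
  have Vfin : P (V @^-1` D) \is a fin_num by rewrite fin_num_measure.
  rewrite -[leLHS]/(P (V @^-1` D)) -(fineK Vfin) -EFinM -EFinD lee_fin.
  apply: le_trans (upper_set_le_last m_gt0 Z_cont Dup) _.
  rewrite lerD2r ler_wpM2l //; apply: ler_sum => i _; apply: fine_prob_le => // w' /=.
  (* Removing the [i]-th score lowers the count by at most one, whence the threshold [k.-1]. *)
  rewrite /D /= (count_belowD1 _ _ _ (ci i)) -/(J i).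
  by case: (_ < _) => /=; rewrite ?add1n ?add0n; case: (k) k0 => // n _; rewrite ?ltnS // => /ltnW.
have sumA : (\sum_(i < m) P (A i) <= (((m - k.-1)%:R : R))%:E)%E.
  pose inA (i : 'I_m) w := (k.-1 <= #|[pred l : 'I_m | (Z (calib l) w < Z (calib i) w)%R]|)%N.
  apply: (@sum_prob_le_overlap _ _ _ _ _ _ _ inA).
  - by move=> i; apply: measurable_count_at_score.
  (* A score is not strictly below itself, so at its own level the count is the same with or without
     it. *)
  - move=> i w; rewrite /A /inA /=.
    have -> : count_below Z (J i) w (Z (calib i) w) =
        count_below Z calib_pred w (Z (calib i) w).
      by rewrite (count_belowD1 _ _ _ (ci i)) ltxx.
    by rewrite /count_below card_calib.
  - by move=> w; apply: (card_high_rank_le _ (fun i => Z (calib i) w)).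
have Mfin : P (miss_event Z k) \is a fin_num.
  by rewrite fin_num_measure //; apply: measurable_miss_event.
rewrite -lee_fin fineK //.
have [-> _] := decoupling_count Z_indep k not_max.
apply: (@le_trans _ _ (\int[P]_w (m%:R^-1%:E * (\sum_(i < m) g i w) + (ks_unif Z)%:E))%E).
  apply: ge0_le_integral => //.
  - exact: measurable_decoupled.
  - apply: emeasurable_funD => //; apply: measurable_funeM.
    by apply: emeasurable_sum => i; apply: mg.
have mS : measurable_fun setT (fun w => (\sum_(i < m) g i w)%E).
  by apply: emeasurable_sum => i; apply: mg.
have S0 w : (0 <= \sum_(i < m) g i w)%E by apply: sume_ge0.
rewrite ge0_integralD //; last 2 first.
- by move=> w _; rewrite mule_ge0 ?lee_fin.
- exact: measurable_funeM.
rewrite integral_cst //= probability_setT mule1 EFinD leeD2r //.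
rewrite ge0_integralZl // ge0_integral_sum //.
rewrite (eq_bigr (fun i => P (A i))) => [|i _]; last exact: gA.
by rewrite mulrC EFinM; apply: lee_wpmul2l; rewrite ?lee_fin.
Qed.
End MissBound.

(** * Coverage of the two prediction sets *)

Theorem corollary5 (d : measure_display) (T : measurableType d) (R : realType)
    (P : probability T R) (m : nat) (XT YT : Type)
    (X : 'I_m.+1 -> T -> XT) (Y : 'I_m.+1 -> T -> YT)
    (score : XT -> YT -> R) (Z : 'I_m.+1 -> {RV P >-> R}) (alpha : R)
    (m_gt0 : (0 < m)%N)
    (score_ge0 : forall x y, 0 <= score x y)
    (ZE : forall i w, Z i w = score (X i w) (Y i w))
    (Z_indep : mutually_independent Z)
    (Z_cont : forall i, continuous_rv (Z i))
    (alpha01 : 0 < alpha < 1) :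
  let C (k : nat) (w : T) : set YT :=
    prediction_set score (calib_quantile Z k w) (X ord_max w) in
  let coverage (k : nat) : R := fine (P [set w | C k w (Y ord_max w)]) in
  (- conformal_delta Z <=
     coverage (conformal_rank m alpha) - (1 - alpha) <=
     (m.+1%:R)^-1 + conformal_delta Z) /\
  (- (3 * ks_unif Z) <=
     coverage (conformal_rank_mod m alpha) - (1 - alpha)).
Proof.
move=> C coverage; have [a0 a1] := andP alpha01.
have m0 : 0 < m%:R :> R by rewrite ltr0n.
have M0 : 0 < m.+1%:R :> R by rewrite ltr0n.
have cov k : (0 < k)%N -> coverage k = 1 - fine (P (miss_event Z k)).
  move=> k0; rewrite /coverage.
  have -> : [set w | C k w (Y ord_max w)] = ~` miss_event Z k.
    apply/seteqP; split => w;
      rewrite /C /prediction_set /calib_quantile /= -ZE order_stat_ge // /miss_event /=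
        /count_below card_calib; by [move/negP|move/negP].
  rewrite probability_setC; last exact: measurable_miss_event.
  by rewrite fineB ?fin_num_measure //; apply: measurable_miss_event.
split.
  (* Rounding up puts [k / (m + 1)] between [1 - alpha] and [1 - alpha + 1 / (m + 1)], the source of
     the extra term in the upper bound. *)
  set k := conformal_rank m alpha.
  have x0 : 0 < m.+1%:R * (1 - alpha) by rewrite mulr_gt0 // subr_gt0.
  have kE : k%:R = (Num.ceil (m.+1%:R * (1 - alpha)))%:~R :> R.
    rewrite /k /conformal_rank -[LHS]/((Posz _)%:~R) gez0_abs //.
    by rewrite ceil_ge0; lra.
  have kge : m.+1%:R * (1 - alpha) <= k%:R by rewrite kE; apply: ceil_ge.
  have klt : k%:R < m.+1%:R * (1 - alpha) + 1.
    by rewrite kE -ltrBlDr; have := ceilB1_lt (m.+1%:R * (1 - alpha)); rewrite intrD.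
  have k0 : (0 < k)%N by rewrite -(ltr0n R); apply: lt_le_trans kge.
  have km : (k <= m.+1)%N.
    rewrite -ltnS -(ltr_nat R); apply: lt_le_trans klt _.
    rewrite -[m.+2%:R]natr1 lerD2r ler_piMr ?ltW //; lra.
  have := miss_event_close m_gt0 Z_indep km; rewrite cov // natrB // ler_norml.
  have -> : (m.+1%:R - k%:R) / m.+1%:R = 1 - k%:R / m.+1%:R :> R.
    by rewrite mulrBl divff // gt_eqF.
  have h1 : 1 - alpha <= k%:R / m.+1%:R by rewrite ler_pdivlMr // mulrC.
  have h2 : k%:R / m.+1%:R <= 1 - alpha + m.+1%:R^-1.
    rewrite ler_pdivrMr // mulrDl mulVf ?gt_eqF // mulrC; exact: ltW.
  move: h1 h2; move: (k%:R / _) (conformal_delta Z) => q D.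
  by move: (m.+1%:R^-1) (fine _) => r f; lra.
set j := `|Num.floor (2 * m%:R * alpha / 3)|%N.
have x0 : 0 <= 2 * m%:R * alpha / 3 by rewrite divr_ge0 // mulr_ge0 ?mulr_ge0 ?ltW.
have jle : j%:R <= 2 * m%:R * alpha / 3.
  rewrite /j -[leLHS]/((Posz _)%:~R) gez0_abs ?floor_ge0 //.
  exact: floor_le.
have jm : (j <= m)%N.
  rewrite -(ler_nat R); apply: le_trans jle _.
  by rewrite ler_pdivrMr //; have := ler_piMr (ltW m0) (ltW a1); lra.
have kE : conformal_rank_mod m alpha = (m.+1 - j)%N by [].
have k0 : (0 < m.+1 - j)%N by rewrite subn_gt0 ltnS.
rewrite kE cov //; have := miss_event_le m_gt0 Z_indep Z_cont k0.
(* With [k = m + 1 - j] one has [m - (k - 1) = j] and [j / m <= 2 alpha / 3], so the miss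
   probability is at most [alpha + ks_unif Z]. *)
have -> : (m - (m.+1 - j).-1)%N = j by rewrite subSn //= subKn.
have : j%:R / m%:R <= 2 * alpha / 3.
  by rewrite ler_pdivrMr //; apply: le_trans jle _; lra.
have := ks_unif_ge0 Z; move: (_ / m%:R) (fine _) => q f; lra.
Qed.
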